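(* Let $n\ge 1$, $r_0>0$, $0<\alpha<\beta<2$, $C>0$, $V_0>0$, and let $(M_i)_{i\ge1}$ be a sequence of $n$-dimensional closed, oriented and connected Riemannian manifolds with $\operatorname{Vol}(M_i)\le V_0$ for all $i$. Suppose that every $M_i$ (with its Riemannian distance) satisfies the $n$-dimensional $(C,\alpha,\beta)$-tetrahedral property for all radii $r\le r_0$. Then a subsequence of $(M_i)$ converges in the Gromov-Hausdorff sense to a noncollapsed metric space. In particular, there exists $D_0=D_0(C,\alpha,\beta,r_0,V_0)>0$ such that $\operatorname{diam}(M_i)\le D_0$ for all $i$.
   Context: For a metric space $(X,d)$ with metric completion $\bar X$ (and $d$ extended to $\bar X$), a point $q\in\bar X$ and $t>0$, put $S(q;t)=\{x\in X: d(x,q)=t\}$. Given $p\in X$, $r>0$, $p_1,\dots,p_{n-1}\in\bar X$ and $t_1,\dots,t_{n-1}>0$, let $S=S(p;r)\cap S(p_1;t_1)\cap\dots\cap S(p_{n-1};t_{n-1})$ and define $$h(p,r,t_1,\dots,t_{n-1})=\begin{cases}\inf\{d(x,y): x\ne y,\ x,y\in S\} & \text{if } |S|\ge 2,\\ 0&\text{otherwise.}\end{cases}$$ For $C>0$ and $0<\alpha<\beta<2$, $(X,d)$ satisfies the $n$-dimensional $(C,\alpha,\beta)$-tetrahedral property at $p$ for radius $r$ if there exist $p_1,\dots,p_{n-1}\in\bar X$ with $d(p,p_i)=r$ for all $i$ such that $h(p,r,t_1,\dots,t_{n-1})\ge Cr$ for all $(t_1,\dots,t_{n-1})\in[\alpha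 r,\beta r]^{n-1}$. The space satisfies the property for radius $r$ if it satisfies it at every point $p\in X$ for radius $r$. ''Noncollapsed'' limit is used in the usual sense: the approximating manifolds have volumes bounded below by a positive constant independent of $i$. The dimension $n$ is fixed, so constants may depend on it. *)

(* Defs.v *)
From HB Require Import structures.
From mathcomp Require Import all_boot all_order all_algebra.
From mathcomp Require Import all_classical all_reals all_analysis.

Set Implicit Arguments.
Unset Strict Implicit.
Unset Printing Implicit Defensive.

Import Order.TTheory GRing.Theory Num.Theory.
Import numFieldNormedType.Exports.

Local Open Scope classical_set_scope.
Local Open Scope ring_scope.

(** * Calculus on R^n *)

Section Calculus.
Context {R : realType}.

Fixpoint iter_partial {n : nat} {V : normedModType R} (s : seq 'I_n)
    (f : 'rV[R]_n -> V) : 'rV[R]_n -> V :=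
  if s is i :: s' then fun x => 'D_(delta_mx 0 i) (iter_partial s' f) x else f.

(** C^infty on [U]; only meant for open [U], where the values of [f] outside
    [U] are irrelevant. *)
Definition smooth_on {n : nat} {V : normedModType R} (U : set 'rV[R]_n)
    (f : 'rV[R]_n -> V) : Prop :=
  forall (s : seq 'I_n) (x : 'rV[R]_n), U x ->
    {for x, continuous (iter_partial s f)} /\
    forall i : 'I_n, derivable (iter_partial s f) x (delta_mx 0 i).

(** Lebesgue integral over R^n of a nonnegative Borel function, as an iterated
    integral (Tonelli). *)
Fixpoint integral_rV (n : nat) : ('rV[R]_n -> \bar R) -> \bar R :=
  if n is n'.+1 then fun f =>
    (\int[lebesgue_measure]_(t in [set: R])
       integral_rV (fun v : 'rV[R]_n' => f (row_mx (t%:M : 'rV[R]_1) v)))%E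
  else fun f => f 0.

End Calculus.

(** * Closed oriented Riemannian manifolds *)

Record chart (R : realType) (n : nat) (T : topologicalType) := Chart {
  chart_dom : set T ;
  chart_fun : T -> 'rV[R]_n ;
  chart_inv : 'rV[R]_n -> T ;
  chart_dom_open : open chart_dom ;
  chart_img_open : open (chart_fun @` chart_dom) ;
  chart_funK : forall x, chart_dom x -> chart_inv (chart_fun x) = x ;
  chart_fun_cont : forall x, chart_dom x -> {for x, continuous chart_fun} ;
  chart_inv_cont : forall u, (chart_fun @` chart_dom) u ->
    {for u, continuous chart_inv}
}.

Definition chart_img (R : realType) (n : nat) (T : topologicalType)
  (c : chart R n T) : set 'rV[R]_n := chart_fun c @` chart_dom c.

Definition chart_overlap (R : realType) (n : nat) (T : topologicalType)
  (c c' : chart R n T) : set 'rV[R]_n :=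
  chart_fun c @` (chart_dom c `&` chart_dom c').

Definition chart_trans (R : realType) (n : nat) (T : topologicalType)
  (c c' : chart R n T) : 'rV[R]_n -> 'rV[R]_n := chart_fun c' \o chart_inv c.

(** The charts form an atlas of the given orientation.
    The metric tensor in the chart [i] is the Gram matrix [gram i], so that the
    squared norm at [u] of the coordinate (row) vector [v] is
    [v *m gram i u *m v^T].  As ['d f u v = v *m 'J f u], the tensor
    transformation law reads [g_i = J g_j J^T]. *)
Record closed_oriented_riemannian (R : realType) (n : nat) := RiemMfd {
  mfd_carrier :> topologicalType ;
  mfd_nonempty : exists x : mfd_carrier, True ;
  mfd_hausdorff : hausdorff_space mfd_carrier ;
  mfd_compact : compact [set: mfd_carrier] ;
  mfd_connected : connected [set: mfd_carrier] ;
  mfd_index : Type ;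
  mfd_chart : mfd_index -> chart R n mfd_carrier ;
  mfd_cover : forall x, exists i, chart_dom (mfd_chart i) x ;
  mfd_smooth : forall i j,
    smooth_on (chart_overlap (mfd_chart i) (mfd_chart j))
      (chart_trans (mfd_chart i) (mfd_chart j)) ;
  mfd_oriented : forall i j u, chart_overlap (mfd_chart i) (mfd_chart j) u ->
    0 < \det ('J (chart_trans (mfd_chart i) (mfd_chart j)) u) ;
  mfd_gram : mfd_index -> 'rV[R]_n -> 'M[R]_n ;
  mfd_gram_smooth : forall i, smooth_on (chart_img (mfd_chart i)) (mfd_gram i) ;
  mfd_gram_sym : forall i u, chart_img (mfd_chart i) u ->
    (mfd_gram i u)^T = mfd_gram i u ;
  mfd_gram_pos : forall i u, chart_img (mfd_chart i) u ->
    forall v : 'rV[R]_n, v != 0 -> 0 < (v *m mfd_gram i u *m v^T) 0 0 ;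
  mfd_gram_trans : forall i j u, chart_overlap (mfd_chart i) (mfd_chart j) u ->
    let f := chart_trans (mfd_chart i) (mfd_chart j) in
    mfd_gram i u = 'J f u *m mfd_gram j (f u) *m ('J f u)^T
}.

Section Riemannian.
Context {R : realType} {n : nat} (M : closed_oriented_riemannian R n).

Definition piece_length (i : mfd_index M) (c : R -> 'rV[R]_n) : R :=
  (\int[lebesgue_measure]_(t in `[0, 1])
     Num.sqrt ((derive1 c t *m mfd_gram i (c t) *m (derive1 c t)^T) 0 0))%R.

(** [path_length x y L]: some piecewise C^1 curve from [x] to [y] has length
    [L].  The curve is cut into finitely many pieces, each C^1 on [0, 1] and
    contained in one chart; a C^1 map on [0, 1] with values in R^n extends to a
    C^1 map on R. *)
Inductive path_length : M -> M -> R -> Prop :=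
| path_nil (x : M) : path_length x x 0
| path_cons (i : mfd_index M) (c : R -> 'rV[R]_n) (z : M) (L : R) :
    (forall t, derivable c t 1) -> continuous (derive1 c) ->
    (forall t, 0 <= t <= 1 -> chart_img (mfd_chart i) (c t)) ->
    path_length (chart_inv (mfd_chart i) (c 1)) z L ->
    path_length (chart_inv (mfd_chart i) (c 0)) z (piece_length i c + L).

Definition riem_dist (x y : M) : R := inf [set L | path_length x y L].

(** Volume of [U_1 `\` A], [U_2 `\` (A `|` U_1)], ... for the successive chart
    domains [U_k] of the list, with density [sqrt (det g)]. *)
Fixpoint vol_along (A : set M) (s : seq (mfd_index M)) : \bar R :=
  if s is i :: s' then
    (integral_rV
       ((fun u => (Num.sqrt (\det (mfd_gram i u)))%:E)
          \_ (chart_fun (mfd_chart i) @` (chart_dom (mfd_chart i) `\` A)))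
     + vol_along (A `|` chart_dom (mfd_chart i)) s')%E
  else 0%E.

(** Every finite list of charts that covers [M] (one exists by compactness)
    computes the Riemannian volume, and any other list gives at most that. *)
Definition riem_vol : \bar R :=
  ereal_sup [set vol_along set0 s | s in [set: seq (mfd_index M)]].

End Riemannian.

(** * Metric notions, for a distance function [d] on a type [X] *)

Section Metric.
Context {R : realType}.

Definition diam {X : Type} (d : X -> X -> R) : \bar R :=
  ereal_sup [set (d xy.1 xy.2)%:E | xy in [set: X * X]].

(** Points of the metric completion are represented by Cauchy sequences. *)
Definition cauchy_seq {X : Type} (d : X -> X -> R) (q : nat -> X) : Prop :=
  forall e : R, 0 < e -> exists N : nat, forall k l : nat,
    (N <= k)%N -> (N <= l)%N -> d (q k) (q l) < e.

Definition cdist {X : Type} (d : X -> X -> R) (x : X) (q : nat -> X) : R :=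
  limn (fun k => d x (q k)).

Section Tetrahedral.
Context {X : Type} (d : X -> X -> R) (n : nat).
Implicit Types (p : X) (q : 'I_n.-1 -> nat -> X) (t : 'I_n.-1 -> R) (r : R).

Definition sphere_meet p r q t : set X :=
  [set x | d x p = r /\ forall i, cdist d x (q i) = t i].

Definition tetra_h p r q t : R :=
  let S := sphere_meet p r q t in
  if `[< exists x y, [/\ S x, S y & x <> y] >]
  then inf [set d xy.1 xy.2 | xy in [set xy : X * X |
              [/\ S xy.1, S xy.2 & xy.1 <> xy.2]]]
  else 0.

Definition tetrahedral_at (C alpha beta : R) p r : Prop :=
  exists q : 'I_n.-1 -> nat -> X,
    [/\ forall i, cauchy_seq d (q i),
        forall i, cdist d p (q i) = r
      & forall t : 'I_n.-1 -> R,
          (forall i, alpha * r <= t i <= beta * r) ->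
          C * r <= tetra_h p r q t].

Definition tetrahedral (C alpha beta r : R) : Prop :=
  forall p : X, tetrahedral_at C alpha beta p r.

End Tetrahedral.

Definition thickening {Z : metricType R} (e : R) (A : set Z) : set Z :=
  [set z | exists2 a, A a & mdist z a < e].

Definition hausdorff_dist {Z : metricType R} (A B : set Z) : \bar R :=
  ereal_inf [set e%:E | e in [set e : R |
    [/\ 0 < e, A `<=` thickening e B & B `<=` thickening e A]]].

Definition isometric_to {X : Type} (d : X -> X -> R) {Z : metricType R}
    (f : X -> Z) : Prop :=
  forall x y, mdist (f x) (f y) = d x y.

Definition gh_dist {X Y : Type} (dX : X -> X -> R) (dY : Y -> Y -> R) : \bar R :=
  ereal_inf [set h | exists (Z : metricType R) (f : X -> Z) (g : Y -> Z),
    [/\ isometric_to dX f, isometric_to dY g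
      & h = hausdorff_dist (range f) (range g)]].

End Metric.

(* Main.v *)
Require Import Defs.
From HB Require Import structures.
From mathcomp Require Import all_boot all_order all_algebra.
From mathcomp Require Import all_classical all_reals all_analysis.
From mathcomp Require Import measurable_realfun.
From mathcomp Require Import ring lra.

Set Implicit Arguments.
Unset Strict Implicit.
Unset Printing Implicit Defensive.

Import Order.TTheory GRing.Theory Num.Theory.
Import numFieldNormedType.Exports.

Local Open Scope classical_set_scope.
Local Open Scope ring_scope.

(** Let the balls [B(x_j, e_j)] cover a space with the tetrahedral property at
    [p] for all radii in [[r, 2 r]].  For each such radius [t] the map
    [x |-> (d(x, p_1), ..., d(x, p_(n-1)))] is 1-Lipschitz and maps the sphere
    [S(p; t)] onto a set containing the cube [[alpha t, beta t]^(n-1)]; hence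
    the sum of [(2 e_j)^(n-1)] over the balls meeting [S(p; t)] is at least
    [((beta - alpha) t)^(n-1)].  Since [B(x_j, e_j)] meets [S(p; t)] only for
    [t] in an interval of length [2 e_j], integrating over [t] bounds the sum of
    [e_j^n], over the balls meeting the annulus, below by a multiple of [r^n].
    On the other hand, a closed Riemannian manifold is covered by arbitrarily
    small balls with the sum of [e_j^n] at most a multiple of the volume: inside
    a chart, use small cells that are cubes for a Cholesky factor [L] of the
    metric tensor [g = L L^T].  Both bounds together give the lower volume bound
    and, applied to the disjoint annuli around separated points, a bound on the
    size of [r]-separated sets in terms of the total volume.  The latter bounds
    the diameter, by connectedness, and yields uniform total boundedness, from
    which Gromov's precompactness theorem follows with an ultraproduct as the
    limit space. *)

(** * Covering cubes by cubes *)

Section LowerIntegral.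
Local Open Scope ereal_scope.
Context d (T : measurableType d) (R : realType) (mu : {measure set T -> \bar R}).
Implicit Types f g : T -> \bar R.

Import HBNNSimple.

(* The integral of a nonnegative function is a supremum over the simple
   functions below it, so that no measurability is needed. *)
Lemma le_integral_nonmeas f g : (forall x, 0 <= f x) -> (forall x, f x <= g x) ->
  \int[mu]_x f x <= \int[mu]_x g x.
Proof.
move=> f0 fg; have g0 x : 0 <= g x by exact: le_trans (fg x).
rewrite !ge0_integralTE//; apply: le_ereal_sup => _ [h hf <-].
by exists h => // x; exact: le_trans (fg x).
Qed.

End LowerIntegral.

Section Covering.
Context {R : realType}.

(** Integrate the pointwise bound over [[l, u]]: the interval of [p] has length [2 * e p] and
    carries the weight [a p]. Parts of it outside [[l, u]] only increase the right-hand side. *)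
Lemma weighted_interval_cover (T : Type) (s : seq T) (c e a : T -> R) (K l u : R) :
  l <= u -> (forall p, 0 <= e p) -> (forall p, 0 <= a p) ->
  (forall x, l <= x <= u -> K <= \sum_(p <- s | `|x - c p| <= e p) a p) ->
  K * (u - l) <= \sum_(p <- s) a p * (2 * e p).
Proof.
move=> lu e0 a0 cov.
(* A negative [K] is settled at once, since the comparison of integrals below needs a nonnegative
   integrand. *)
have [K0|/ltW K0] := leP 0 K; last first.
  rewrite (@le_trans _ _ 0)//; first by rewrite mulr_le0_ge0// subr_ge0.
  by rewrite sumr_ge0// => p _; rewrite mulr_ge0// mulr_ge0.
rewrite -lee_fin.
have leb (x y : R) : x <= y ->
    (@lebesgue_measure R : {measure set _ -> \bar R}) `[x, y]%classic = (y - x)%:E.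
  move=> xy; apply: (etrans (lebesgue_measure_itv _)); rewrite /= lte_fin.
  by case: ltgtP xy => // -> _; rewrite subrr.
pose I p := `[c p - e p, c p + e p]%classic.
have -> : ((K * (u - l))%:E = \int[lebesgue_measure]_x (K%:E * (\1_(`[l, u]) x)%:E))%E.
  rewrite ?/I ge0_integralZl_EFin//=; last by apply/measurable_EFinP.
  by rewrite integral_indic// setIT leb// EFinM.
have -> : ((\sum_(p <- s) a p * (2 * e p))%:E =
    \int[lebesgue_measure]_x \sum_(p <- s) ((a p)%:E * (\1_(I p) x)%:E))%E.
  rewrite ge0_integral_sum//=; last 2 first.
  - by move=> p; rewrite /I; apply: measurable_funeM; apply/measurable_EFinP.
  - by move=> p x _; rewrite mule_ge0// lee_fin.
  rewrite -sumEFin; apply: eq_bigr => p _.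
  rewrite ?/I ge0_integralZl_EFin//=; last by apply/measurable_EFinP.
  rewrite /I integral_indic// setIT leb; last by rewrite lerD2l -subr_ge0 opprK addr_ge0.
  by rewrite -EFinM; congr (_%:E); ring.
apply: le_integral_nonmeas => x.
  by rewrite mule_ge0// lee_fin.
under eq_bigr do rewrite -EFinM.
rewrite sumEFin lee_fin indicE; case: (boolP (x \in _)) => xI; last first.
  by rewrite mulr0 sumr_ge0// => p _; rewrite mulr_ge0.
rewrite mulr1; move: xI; rewrite inE/= ?in_itv/= => /cov /le_trans; apply.
rewrite big_mkcond/=; apply: ler_sum => p _.
rewrite indicE; case: ifPn => h; last by rewrite mulr_ge0.
by rewrite mem_set ?mulr1// /I /= in_itv /= -ler_distl.
Qed.

(** Induction on the dimension. The small cubes whose last interval contains [x] cover the slice at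
    [x], so their volumes in one dimension less add up to [(u - l)^k] at least; integrating over [x]
    supplies the last factor. Points are functions on [nat] read below [k], so slicing needs no
    reindexing. *)
Lemma cube_cover (k : nat) (l u : R) (T : eqType) (s : seq T) (c : T -> nat -> R)
    (e : T -> R) :
  l <= u -> (forall p, 0 <= e p) ->
  (forall t : nat -> R, (forall i, (i < k)%N -> l <= t i <= u) ->
     exists2 p, p \in s & forall i, (i < k)%N -> `|t i - c p i| <= e p) ->
  (u - l) ^+ k <= \sum_(p <- s) (2 * e p) ^+ k.
Proof.
move=> lu e0; elim: k s => [|k IH] s cov.
  (* In dimension 0 the covering hypothesis says that [s] is nonempty. *)
  have [//|p ps _] := cov (fun=> 0).
  rewrite expr0; under eq_bigr do rewrite expr0.
  rewrite big_tnth sumr_const card_ord ler1n.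
  by case: s ps {cov}.
rewrite exprSr.
under eq_bigr do rewrite exprSr.
apply: (@weighted_interval_cover _ _ (c ^~ k)) => //.
  by move=> p; rewrite exprn_ge0// mulr_ge0.
move=> x xlu; rewrite -big_filter; apply: IH => t ht.
have [i ik|p ps hp] := cov (fun i => if i == k then x else t i).
  case: eqP => [//|/eqP nik]; apply: ht.
  by rewrite ltn_neqAle nik -ltnS.
exists p; first by rewrite mem_filter ps andbT; have := hp k; rewrite eqxx; apply.
move=> i ik; have := hp i; rewrite ltn_eqF//; apply; exact: ltnW.
Qed.

End Covering.

(** * Pseudometrics and the tetrahedral property *)

Definition pseudometric {R : realType} {X : Type} (d : X -> X -> R) : Prop :=
  [/\ forall x, d x x = 0, forall x y, d x y = d y x
    & forall y x z, d x z <= d x y + d y z].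

Definition ball_cover {R : realType} {X : eqType} (d : X -> X -> R)
    (s : seq (X * R)) (E : set X) : Prop :=
  forall y, E y -> exists2 p, p \in s & d p.1 y < p.2.

Section Pseudometric.
Context {R : realType} {X : Type} (d : X -> X -> R) (dP : pseudometric d).

Lemma pdist_sym x y : d x y = d y x. Proof. by case: dP. Qed.
Lemma pdistxx x : d x x = 0. Proof. by case: dP. Qed.
Lemma pdist_tri y x z : d x z <= d x y + d y z. Proof. by case: dP. Qed.
Lemma pdist_ge0 x y : 0 <= d x y.
Proof.
have := pdist_tri y x x; rewrite pdistxx (pdist_sym y x); lra.
Qed.

Lemma pdist_lip x y z : `|d x z - d y z| <= d x y.
Proof.
rewrite ler_distlC; have := pdist_tri x y z; have := pdist_tri y x z.
by rewrite (pdist_sym y x) => h1 h2; apply/andP; split; lra.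
Qed.

Lemma cvg_cdist x q : cauchy_seq d q -> cvgn (fun k => d x (q k)).
Proof.
move=> cq; apply/cauchy_cvgP; apply/cauchy_ballP => e e0.
have [N hN] := cq e e0.
exists ([set d x (q k) | k in [set k | (N <= k)%N]], [set d x (q k) | k in [set k | (N <= k)%N]]).
  by split; exists N => // k /= Nk; exists k.
move=> [a b] /= [[k Nk <-] [l Nl <-]].
rewrite /ball/= !(pdist_sym x).
by rewrite (le_lt_trans (pdist_lip _ _ _))// hN.
Qed.

Lemma cdist_lip x y q : cauchy_seq d q -> `|cdist d x q - cdist d y q| <= d x y.
Proof.
move=> cq.
have cx := @cvg_cdist x q cq; have cy := @cvg_cdist y q cq.
have c : (fun k => `|d x (q k) - d y (q k)|) @ \oo --> `|cdist d x q - cdist d y q|.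
  by apply: cvg_norm; apply: cvgB.
apply: (cvgr_to_le c).
by near=> k; exact: pdist_lip.
Unshelve. all: by end_near. Qed.

End Pseudometric.

Section Packing.
Context {R : realType} {X : eqType} (d : X -> X -> R) (dP : pseudometric d).
Variables (n : nat) (C alpha beta : R).
Hypotheses (n1 : (1 <= n)%N) (C0 : 0 < C) (ab : alpha < beta).

(** Two nested coverings: the radii [[r, 2 r]] by intervals centred at [d p.1 x], and for each
    radius [t] a cube of dimension [n - 1] by the distances to the vertices. A ball meeting a sphere
    of radius at most [2 r] has its centre within [2 r + delta] of [x]. *)
Lemma tetrahedral_annulus (r delta : R) (x : X) (s : seq (X * R)) :
  0 < r ->
  (forall t, r <= t <= 2 * r -> tetrahedral_at d n C alpha beta x t) ->
  (forall p, p \in s -> 0 < p.2 <= delta) -> ball_cover d s setT ->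
  ((beta - alpha) * r) ^+ n.-1 * r <=
    \sum_(p <- s | d p.1 x < 2 * r + delta) (2 * p.2) ^+ n.
Proof.
move=> r0 tet sd cov; have abW : alpha <= beta by exact: ltW.
rewrite -big_filter; set s1 := [seq p <- s | _].
(* The covering lemmas want a nonnegative radius for every pair, also outside [s]. *)
pose e (p : X * R) := `|p.2|.
have s1e p : p \in s1 -> e p = p.2.
  by rewrite mem_filter => /andP[_ /sd/andP[p0 _]]; rewrite /e gtr0_norm.
have -> : \sum_(p <- s1) (2 * p.2) ^+ n = \sum_(p <- s1) (2 * e p) ^+ n.-1 * (2 * e p).
  by apply: eq_big_seq => p /s1e ->; rewrite -exprSr prednK.
have -> : ((beta - alpha) * r) ^+ n.-1 * r = ((beta - alpha) * r) ^+ n.-1 * (2 * r - r) by ring.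
apply: (@weighted_interval_cover _ _ _ (fun p => d p.1 x)).
- lra.
- by move=> p; exact: normr_ge0.
- by move=> p; rewrite exprn_ge0// mulr_ge0// normr_ge0.
move=> t rt; have /andP[rt1 rt2] := rt.
have [q [cq _ hq]] := tet t rt.
apply: (@le_trans _ _ ((beta * t - alpha * t) ^+ n.-1)).
  have ab0 : 0 <= beta - alpha by rewrite subr_ge0 ltW.
  have t0 : 0 <= t by lra.
  by rewrite -mulrBl lerXn2r ?nnegrE ?mulr_ge0 ?(ltW r0)// ler_wpM2l//; lra.
pose c (p : X * R) (i : nat) : R :=
  if @idP (i < n.-1)%N is ReflectT h then cdist d p.1 (q (Ordinal h)) else 0.
rewrite -big_filter; apply: (@cube_cover _ _ _ _ _ _ c).
- by rewrite ler_wpM2r//; lra.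
- by move=> p; exact: normr_ge0.
move=> u hu.
have := hq (fun i => u (val i)) (fun i => hu _ (ltn_ord i)).
(* With fewer than two common points [tetra_h] would be 0, against [C * t > 0]; so some [y] has all
   the prescribed distances. *)
rewrite /tetra_h; case: asboolP => [[y [_ [[yt yu] _ _]]] _|_]; last first.
  have t0 : 0 < t by lra.
  by rewrite leNgt mulr_gt0.
have [//|p ps dp] := cov y.
have pe : e p = p.2 by rewrite /e gtr0_norm//; case/andP: (sd _ ps).
have dxy : `|t - d p.1 x| <= d p.1 y.
  by rewrite -yt distrC pdist_lip.
exists p.
  rewrite !mem_filter ps andbT; apply/andP; split.
    by rewrite pe (le_trans dxy)// ltW.
  have := pdist_tri dP y p.1 x; rewrite yt; case/andP: (sd _ ps); lra.
move=> i ik; rewrite /c; case: {-}_ / idP => [h|//].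
rewrite -(_ : cdist d y (q (Ordinal h)) = u i); last by rewrite yu.
by rewrite pe distrC (le_trans (cdist_lip dP _ _ (cq _)))// ltW.
Qed.

(** A ball counted for [x i] has its centre within [2 (r / 8) + delta < r / 2] of [x i]. By
    separation each ball is counted for one [i] at most, so the annulus bounds may be added. *)
Lemma tetrahedral_packing (r r0 delta : R) (N : nat) (x : 'I_N -> X) (s : seq (X * R)) :
  0 < r -> r <= r0 -> delta <= r / 8 ->
  (forall t, 0 < t -> t <= r0 -> tetrahedral d n C alpha beta t) ->
  (forall p, p \in s -> 0 < p.2 <= delta) -> ball_cover d s setT ->
  (forall i j, i != j -> r <= d (x i) (x j)) ->
  N%:R * (((beta - alpha) * (r / 8)) ^+ n.-1 * (r / 8)) <=
    2 ^+ n * \sum_(p <- s) p.2 ^+ n.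
Proof.
move=> rp rr0 dr tet sd cov sep.
have -> : 2 ^+ n * \sum_(p <- s) p.2 ^+ n = \sum_(p <- s) (2 * p.2) ^+ n.
  by rewrite big_distrr; apply: eq_bigr => p _; rewrite exprMn.
have K i : ((beta - alpha) * (r / 8)) ^+ n.-1 * (r / 8) <=
    \sum_(p <- s | d p.1 (x i) < r / 2) (2 * p.2) ^+ n.
  apply: le_trans (_ : _ <= \sum_(p <- s | d p.1 (x i) < 2 * (r / 8) + delta) (2 * p.2) ^+ n) _.
    apply: tetrahedral_annulus => //; first lra.
    by move=> t ht; apply: tet; lra.
  rewrite big_mkcond [leRHS]big_mkcond big_seq [leRHS]big_seq/=.
  apply: ler_sum => p /sd/andP[p0 _].
  have h0 : 0 <= (2 * p.2) ^+ n by rewrite exprn_ge0//; lra.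
  by case: ifPn => h1; case: ifPn => // h2; move: h1 h2; lra.
have -> : N%:R * (((beta - alpha) * (r / 8)) ^+ n.-1 * (r / 8)) =
   \sum_(i < N) (((beta - alpha) * (r / 8)) ^+ n.-1 * (r / 8)).
  by rewrite sumr_const card_ord mulr_natl.
apply: le_trans (ler_sum _ (fun i _ => K i)) _.
under eq_bigr do rewrite big_mkcond.
rewrite exchange_big/= big_seq [leRHS]big_seq.
apply: ler_sum => p /sd/andP[p0 _].
have h0 : 0 <= (2 * p.2) ^+ n by rewrite exprn_ge0//; lra.
have [/existsP[i hi]|] := boolP [exists i, d p.1 (x i) < r / 2]; last first.
  rewrite negb_exists => /forallP h; rewrite big1// => i _.
  by rewrite (negbTE (h i)).
rewrite (bigD1 i)//= hi big1 ?addr0// => j ji.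
case: ifPn => // hj; have := sep _ _ ji.
have := pdist_tri dP p.1 (x j) (x i); rewrite (pdist_sym dP (x j) p.1); lra.
Qed.

End Packing.

(** * The iterated integral *)

Section IteratedIntegral.
Local Open Scope ereal_scope.
Context {R : realType}.

Let mu := (@lebesgue_measure R : {measure set _ -> \bar R}).

Definition slice (n : nat) (f : 'rV[R]_n.+1 -> \bar R) (t : R) : 'rV[R]_n -> \bar R :=
  fun v => f (row_mx (t%:M : 'rV[R]_1) v).

(** Integrability is asked of every slice, not of almost every one, so that sums, multiples and
    dominated limits can be treated one variable at a time. *)
Fixpoint iter_integrable (n : nat) : ('rV[R]_n -> \bar R) -> Prop :=
  if n is n'.+1 then fun f =>
    (forall t, iter_integrable (slice f t)) /\
    mu.-integrable setT (fun t => integral_rV (slice f t))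
  else fun f => f 0%R \is a fin_num.

Lemma integral_rVS n (f : 'rV[R]_n.+1 -> \bar R) :
  integral_rV f = \int[mu]_t integral_rV (slice f t).
Proof. by []. Qed.

Lemma integral_rV_ge0 n (f : 'rV[R]_n -> \bar R) :
  (forall u, 0 <= f u) -> 0 <= integral_rV f.
Proof.
elim: n f => [|n IH] f f0; first exact: f0.
by rewrite integral_rVS; apply: integral_ge0 => t _; apply: IH => v; exact: f0.
Qed.

Lemma le_integral_rV n (f g : 'rV[R]_n -> \bar R) :
  (forall u, 0 <= f u) -> (forall u, f u <= g u) ->
  integral_rV f <= integral_rV g.
Proof.
elim: n f g => [|n IH] f g f0 fg; first exact: fg.
rewrite !integral_rVS; apply: le_integral_nonmeas => t.
  by apply: integral_rV_ge0 => v; exact: f0.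
by apply: IH => v; [exact: f0|exact: fg].
Qed.

Lemma integral_rV_fin n (f : 'rV[R]_n -> \bar R) :
  iter_integrable f -> integral_rV f \is a fin_num.
Proof.
case: n f => [|n] f; first by [].
by move=> [_ h]; rewrite integral_rVS; apply: integrable_fin_num.
Qed.

Lemma integral_rV0 n : integral_rV (cst 0 : 'rV[R]_n -> \bar R) = 0.
Proof.
elim: n => [//|n IH]; rewrite integral_rVS.
by under eq_integral do rewrite IH; rewrite integral0.
Qed.

Lemma iter_integrable0 n : iter_integrable (cst 0 : 'rV[R]_n -> \bar R).
Proof.
elim: n => [//|n IH] /=; split=> [t|]; first exact: IH.
rewrite [X in integrable _ _ X](_ : _ = cst 0); first exact: integrable0.
by apply/funext => t; exact: integral_rV0.
Qed.

Lemma iter_integrableD n (f g : 'rV[R]_n -> \bar R) :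
  iter_integrable f -> iter_integrable g ->
  iter_integrable (fun u => f u + g u) /\
  integral_rV (fun u => f u + g u) = integral_rV f + integral_rV g.
Proof.
elim: n f g => [|n IH] f g; first by move=> /= ff fg; rewrite fin_numD ff.
move=> [f1 f2] [g1 g2].
have E t := IH _ _ (f1 t) (g1 t).
have EE : (fun t => integral_rV (slice (fun u => f u + g u) t)) =
    (fun t => integral_rV (slice f t) + integral_rV (slice g t)).
  by apply/funext => t; have [_] := E t.
split; last by rewrite !integral_rVS EE integralD.
by split=> [t|]; [have [] := E t|rewrite EE; exact: integrableD].
Qed.

Lemma iter_integrable_sum n (I : Type) (s : seq I) (f : I -> 'rV[R]_n -> \bar R) :
  (forall i, iter_integrable (f i)) ->
  iter_integrable (fun u => \sum_(i <- s) f i u) /\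
  integral_rV (fun u => \sum_(i <- s) f i u) = \sum_(i <- s) integral_rV (f i).
Proof.
move=> fi; elim: s => [|i s [IH1 IH2]].
  rewrite big_nil (_ : (fun _ => _) = cst 0).
    by split; [exact: iter_integrable0|exact: integral_rV0].
  by apply/funext => u; rewrite big_nil.
rewrite big_cons -IH2 (_ : (fun _ => _) = (fun u => f i u + \sum_(i <- s) f i u)).
  exact: iter_integrableD.
by apply/funext => u; rewrite big_cons.
Qed.

Lemma iter_integrableZ n (c : R) (f : 'rV[R]_n -> \bar R) :
  iter_integrable f ->
  iter_integrable (fun u => c%:E * f u) /\
  integral_rV (fun u => c%:E * f u) = c%:E * integral_rV f.
Proof.
elim: n f => [|n IH] f; first by move=> /= ff; rewrite fin_numM.
move=> [f1 f2].
have E t := IH _ (f1 t).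
have EE : (fun t => integral_rV (slice (fun u => c%:E * f u) t)) =
    (fun t => c%:E * integral_rV (slice f t)).
  by apply/funext => t; have [_] := E t.
split; last by rewrite !integral_rVS EE integralZl.
by split=> [t|]; [have [] := E t|rewrite EE; exact: integrableZl].
Qed.

(** By induction the integrals of the slices converge for every [t], and they are dominated by those
    of the slices of [g]; dominated convergence in one variable then applies. *)
Lemma iter_dominated_convergence n (f_ : nat -> 'rV[R]_n -> \bar R)
    (f g : 'rV[R]_n -> \bar R) :
  (forall m u, 0 <= f_ m u <= g u) ->
  (forall m, iter_integrable (f_ m)) -> iter_integrable g ->
  (forall u, f_ ^~ u @ \oo --> f u) ->
  iter_integrable f /\ (fun m => integral_rV (f_ m)) @ \oo --> integral_rV f.
Proof.
elim: n f_ f g => [|n IH] f_ f g fg.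
  move=> /= ff gg cv; split; last exact: cv.
  have h0 : 0 <= f 0%R by apply: (cvge_to_ge (cv 0%R)); apply: nearW => m; case/andP: (fg m 0%R).
  have h1 : f 0%R <= g 0%R by apply: (cvge_to_le (cv 0%R)); apply: nearW => m; case/andP: (fg m 0%R).
  by rewrite ge0_fin_numE// (le_lt_trans h1)// ltey_eq gg.
move=> ff gg cv.
have E t : iter_integrable (slice f t) /\
    (fun m => integral_rV (slice (f_ m) t)) @ \oo --> integral_rV (slice f t).
  apply: (IH _ _ (slice g t)).
  - by move=> m v; exact: (fg m (row_mx t%:M v)).
  - by move=> m; have [h _] := ff m; exact: h.
  - by have [h _] := gg; exact: h.
  - by move=> v; exact: (cv (row_mx t%:M v)).
have mf : measurable_fun setT (fun t => integral_rV (slice f t)).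
  apply: (@emeasurable_fun_cvg _ _ _ _ (fun m t => integral_rV (slice (f_ m) t))).
    by move=> m; have [_ /measurable_int] := ff m.
  by move=> t _; have [_] := E t.
have [] := @dominated_convergence _ _ _ mu setT measurableT
  (fun m t => integral_rV (slice (f_ m) t)) (fun t => integral_rV (slice f t))
  (fun t => integral_rV (slice g t)).
- by move=> m; have [_ /measurable_int] := ff m.
- exact: mf.
- by apply: aeW => t _; have [_] := E t.
- by have [] := gg.
- apply: aeW => t m _; rewrite gee0_abs.
    apply: le_integral_rV => v; first by case/andP: (fg m (row_mx t%:M v)).
    by case/andP: (fg m (row_mx t%:M v)).
  by apply: integral_rV_ge0 => v; case/andP: (fg m (row_mx t%:M v)).
move=> ig _ cvI; split; last exact: cvI.
by split=> // t; have [] := E t.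
Qed.

End IteratedIntegral.

(** * Cholesky factors and cells *)

Section UpperTriangular.
Context {R : realType}.

(** Upper triangular with positive diagonal, stated on blocks to match [integral_rV], which splits
    off the first coordinate. *)
Fixpoint upper_pos (n : nat) : 'M[R]_n -> Prop :=
  if n is n'.+1 then fun L : 'M[R]_(1 + n') =>
    [/\ dlsubmx L = 0, 0 < ulsubmx L 0 0 & upper_pos (drsubmx L)]
  else fun _ => True.

Lemma det_dlsubmx0 n (L : 'M[R]_(1 + n)) : dlsubmx L = 0 ->
  \det L = ulsubmx L 0 0 * \det (drsubmx L).
Proof.
by move=> dl; rewrite -det_mx11 -(det_ublock _ (ursubmx L)) -dl submxK.
Qed.

Lemma upper_pos_det n (L : 'M[R]_n) : upper_pos L -> 0 < \det L.
Proof.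
elim: n L => [|n IH] L; first by rewrite det_mx00.
move=> [/= dl ul /IH dr].
by rewrite (det_dlsubmx0 dl) mulr_gt0.
Qed.

(** Induction from the lower right block [g11 = L' L'^T]: the row [b] solves [b L'^T = g01], and the
    corner entry is the square root of the Schur complement [g00 - b b^T]. *)
Lemma cholesky n (g : 'M[R]_n) : g^T = g ->
  (forall v : 'rV[R]_n, v != 0 -> 0 < (v *m g *m v^T) 0 0) ->
  exists L, upper_pos L /\ g = L *m L^T.
Proof.
elim: n g => [|n IH] g gs gp.
  by exists 0; split=> //; apply/matrixP => -[].
pose g' : 'M[R]_(1 + n) := g.
have gs' : g'^T = g' by exact: gs.
have gp' : forall v : 'rV[R]_(1 + n), v != 0 -> 0 < (v *m g' *m v^T) 0 0 by exact: gp.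
set g00 := ulsubmx g'; set g01 := ursubmx g'; set g11 := drsubmx g'.
have g10 : dlsubmx g' = g01^T by rewrite /g01 -[in RHS]gs' -trmx_dlsub trmxK.
have gE : g' = block_mx g00 g01 g01^T g11 by rewrite -g10 submxK.
have [L' [L'u L'E]] : exists L', upper_pos L' /\ g11 = L' *m L'^T.
  apply: IH; first by rewrite trmx_drsub gs'.
  move=> v v0; have : row_mx (0 : 'M[R]_1) v != 0.
    by apply: contra_neq v0 => e; rewrite -(row_mxKr (0 : 'M[R]_1) v) e linear0.
  move/gp'; rewrite gE (mul_row_block 0 v) tr_row_mx mul_row_col.
  by rewrite !mul0mx !add0r trmx0 mulmx0 add0r.
have L'unit : L' \in unitmx by rewrite unitmxE unitfE gt_eqF// upper_pos_det.
pose b := g01 *m invmx L'^T.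
have bE : b *m L'^T = g01 by rewrite mulmxKV// unitmx_tr.
have l0 : 0 < (g00 - b *m b^T) 0 0.
  (* This [w] minimises the quadratic form over the rows [(1, w)]; the minimum is the Schur
     complement. *)
  pose w := - (b *m invmx L').
  have : row_mx (1%:M : 'M[R]_1) w != 0.
    apply/eqP => /rowP/(_ (lshift n 0)); rewrite row_mxEl !mxE/= => /eqP.
    by rewrite oner_eq0.
  move/gp'; rewrite gE (mul_row_block 1%:M w) tr_row_mx mul_row_col.
  rewrite !mul1mx trmx1 mulmx1 L'E.
  have wL : w *m L' = - b by rewrite mulNmx mulmxKV.
  rewrite -bE trmx_mul trmxK !(mulmxA w) !wL.
  by rewrite [- b *m L'^T]mulNmx addrN mul0mx addr0 mulNmx.
pose s : R := Num.sqrt ((g00 - b *m b^T) 0 0).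
have LE : g' = block_mx s%:M b 0 L' *m (block_mx s%:M b 0 L')^T.
  rewrite gE tr_block_mx mulmx_block trmx0 !mul0mx !mulmx0 !add0r.
  rewrite bE -L'E -bE trmx_mul trmxK; congr block_mx.
  rewrite tr_scalar_mx -scalar_mxM -expr2 sqr_sqrtr ?ltW//.
  by rewrite -mx11_scalar subrK.
exists (block_mx s%:M b 0 L'); split; last exact: LE.
by rewrite /= block_mxKdl block_mxKul block_mxKdr mxE eqxx mulr1n sqrtr_gt0.
Qed.

End UpperTriangular.

(** * Half-open cells adapted to a triangular frame *)

Section Cells.
Context {R : realType}.

(** The preimage of a half-open cube under [u |-> u L]; half-open, so that the cells of a grid are
    disjoint. *)
Definition in_cell n (L : 'M[R]_n) (a : 'rV[R]_n) (h : R) (u : 'rV[R]_n) : bool :=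
  [forall j, a 0 j <= (u *m L) 0 j < a 0 j + h].

Lemma in_cellS n (L : 'M[R]_(1 + n)) a h t v : dlsubmx L = 0 ->
  in_cell L a h (row_mx (t%:M : 'M[R]_1) v) =
  (a 0 0 <= t * ulsubmx L 0 0 < a 0 0 + h) &&
  in_cell (drsubmx L) (rsubmx (a : 'rV[R]_(1 + n)) - t *: ursubmx L) h v.
Proof.
move=> dl; have E : row_mx (t%:M : 'M[R]_1) v *m L =
    row_mx (t *: ulsubmx L) (t *: ursubmx L + v *m drsubmx L).
  by rewrite -{1}(submxK L) dl mul_row_block mulmx0 addr0 !mul_scalar_mx.
apply/forallP/andP => [H|[H0 /forallP H] j].
  split.
    have := H (lshift n 0); rewrite E row_mxEl mxE.
    by rewrite (_ : lshift n 0 = 0)//; apply/val_inj.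
  apply/forallP => j; have := H (rshift 1 j); rewrite E row_mxEr !mxE.
  by move=> h'; lra.
rewrite E; case: (split_ordP j) => k ->; last first.
  by rewrite row_mxEr; have := H k; rewrite !mxE => h'; lra.
rewrite row_mxEl !ord1 mxE; move: H0.
by rewrite (_ : lshift n 0 = 0)//; apply/val_inj.
Qed.

(** As [L] is upper triangular, the first coordinate of [u L] involves only the first one of [u]: it
    confines [t] to an interval of length [h / l], and the slice at [t] is a translated cell of the
    minor. The factor [c] lets the induction absorb the indicator of that interval. *)
Lemma integral_cell n (L : 'M[R]_n) (a : 'rV[R]_n) (h c : R) :
  upper_pos L -> 0 <= h ->
  iter_integrable (fun u => (c * (in_cell L a h u)%:R)%:E) /\
  integral_rV (fun u => (c * (in_cell L a h u)%:R)%:E) = (c * (h ^+ n / \det L))%:E.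
Proof.
elim: n L a c => [|n IH] L a c Lu h0.
  split=> //=; rewrite det_mx00 expr0 divr1; congr (_ * _)%:E.
  by rewrite /in_cell; case: forallP => // H; exfalso; apply: H => -[].
have [dl ul dr] : upper_pos (L : 'M[R]_(1 + n)) by exact: Lu.
set l := ulsubmx _ 0 0 in ul.
pose I := [set t : R | a 0 0 <= t * l < a 0 0 + h].
have sE t : slice (fun u => (c * (in_cell L a h u)%:R)%:E) t =
    (fun v => ((c * \1_I t) *
      (in_cell (drsubmx (L : 'M[R]_(1 + n))) (rsubmx (a : 'rV[R]_(1 + n)) - t *: ursubmx (L : 'M[R]_(1 + n))) h v)%:R)%:E).
  apply/funext => v; rewrite /slice in_cellS// -mulnb natrM mulrA indicE.
  congr (c * _ * _)%:E; rewrite -/l.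
  by case: (boolP (_ <= _ < _)) => hI; [rewrite mem_set|rewrite memNset//; apply/negP].
have IE : I = `[a 0 0 / l, (a 0 0 + h) / l[%classic.
  apply/seteqP; split=> t; rewrite /I/= in_itv/= ler_pdivrMr// ltr_pdivlMr//.
have mI : measurable (I : set (measurableTypeR R)) by rewrite IE.
have muI : (@lebesgue_measure R : {measure set _ -> \bar R}) I = (h / l)%:E.
  rewrite IE; apply: (etrans (lebesgue_measure_itv _)); rewrite /= lte_fin.
  case: ltP => [_|]; first by congr (_%:E); rewrite mulrDl addrC addKr.
  rewrite ler_pM2r ?invr_gt0// => hh.
  have -> : h = 0 by lra.
  by rewrite mul0r.
have EE : (fun t => integral_rV (slice (fun u => (c * (in_cell L a h u)%:R)%:E) t)) =
    (fun t => ((c * (h ^+ n / \det (drsubmx (L : 'M[R]_(1 + n)))))%:E * (\1_I t)%:E)%E).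
  apply/funext => t; rewrite sE.
  have [_ ->] := IH _ (rsubmx (a : 'rV[R]_(1 + n)) - t *: ursubmx (L : 'M[R]_(1 + n))) (c * \1_I t) dr h0.
  by rewrite -EFinM; congr (_%:E); ring.
have iI : (@lebesgue_measure R : {measure set _ -> \bar R}).-integrable setT (fun t => (\1_I t)%:E).
  by rewrite IE; exact: integrable_indic_itv.
split.
  split=> [t|]; last by rewrite EE; exact: integrableZl.
  rewrite sE.
  by have [] := IH _ (rsubmx (a : 'rV[R]_(1 + n)) - t *: ursubmx (L : 'M[R]_(1 + n))) (c * \1_I t) dr h0.
rewrite integral_rVS EE integralZl// integral_indic// setIT muI -EFinM; congr (_%:E).
rewrite (det_dlsubmx0 dl) -/l exprS.
have d0 := upper_pos_det dr.
by field; rewrite !gt_eqF.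
Qed.

End Cells.

(** * Metric tensors near a point *)

Section MatrixNorm.
Context {R : realType}.

Lemma norm_mx_entry m n (A : 'M[R]_(m, n)) i j : `|A i j| <= `|A|.
Proof.
rewrite [leRHS]mx_normrE.
exact: (@le_bigmax _ _ _ 0 (fun ij : 'I_m * 'I_n => `|A ij.1 ij.2|) (i, j)).
Qed.

Lemma norm_mx_le m n (A : 'M[R]_(m, n)) x :
  0 <= x -> (forall i j, `|A i j| <= x) -> `|A| <= x.
Proof.
by move=> x0 h; rewrite [leLHS]mx_normrE; apply: bigmax_le => // -[i j] _.
Qed.

Lemma norm_mulmx m n p (A : 'M[R]_(m, n)) (B : 'M[R]_(n, p)) :
  `|A *m B| <= n%:R * (`|A| * `|B|).
Proof.
apply: norm_mx_le => [|i j]; first by rewrite !mulr_ge0.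
rewrite mxE (le_trans (ler_norm_sum _ _ _))//.
apply: (@le_trans _ _ (\sum_(k < n) (`|A| * `|B|))).
  by apply: ler_sum => k _; rewrite normrM ler_pM ?norm_mx_entry.
by rewrite sumr_const card_ord mulr_natl.
Qed.

Lemma cvg_mx_entry (T : Type) (F : set_system T) m n (A : T -> 'M[R]_(m, n))
    (B : 'M[R]_(m, n)) i j :
  Filter F -> A @ F --> B -> A x i j @[x --> F] --> B i j.
Proof.
move=> FF AB; apply: (cvg_comp A (fun M : 'M[R]_(m, n) => M i j) AB).
exact: coord_continuous.
Qed.

Lemma cvg_det (T : Type) (F : set_system T) n (A : T -> 'M[R]_n) (B : 'M[R]_n) :
  Filter F -> A @ F --> B -> (\det (A x)) @[x --> F] --> \det B.
Proof.
move=> FF AB; rewrite /determinant.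
apply: cvg_big => //; first exact: add_continuous.
move=> s _; apply: cvgM; first exact: cvg_cst.
apply: cvg_big => //; first exact: mul_continuous.
by move=> i _; exact: cvg_mx_entry.
Qed.

(* With [g u0 = L L^T], the matrix of [g u] in the frame given by [L] is close to
   the identity. *)
Lemma near_gram n (g : 'rV[R]_n -> 'M[R]_n) (u0 : 'rV[R]_n) :
  {for u0, continuous g} -> (g u0)^T = g u0 ->
  (forall v : 'rV[R]_n, v != 0 -> 0 < (v *m g u0 *m v^T) 0 0) ->
  exists2 L : 'M[R]_n, upper_pos L & \forall u \near u0,
    (forall w : 'rV[R]_n, (w *m g u *m w^T) 0 0 <= (2 * n%:R * `|w *m L|) ^+ 2) /\
    \det L <= 2 * Num.sqrt (\det (g u)).
Proof.
move=> cg gs gp; have [L [Lu gE]] := cholesky gs gp.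
have d0 := upper_pos_det Lu.
have Lunit : L \in unitmx by rewrite unitmxE unitfE gt_eqF.
exists L => //.
(* If [g u] is within [e] of [g u0], conjugation by the inverse of [L] gives a matrix within
   [K * e <= 1] of the identity. *)
pose K := n%:R * ((n%:R * (`|invmx L| * 1)) * `|(invmx L)^T|).
pose e : R := (1 + K)^-1.
have K0 : 0 <= K by rewrite !mulr_ge0.
have e0 : 0 < e by rewrite invr_gt0; lra.
have near1 : \forall u \near u0, `|g u0 - g u| < e by move/cvgrPdist_lt : (cg); exact.
(* Since [\det (g u0)] is the square of [\det L], this is an open condition that holds at [u0]; its
   square root is the density bound. *)
have near2 : \forall u \near u0, (\det L / 2) ^+ 2 < \det (g u).
  have c : \det (g u) @[u --> u0] --> \det (g u0) by exact: (@cvg_det _ _ _ _ _ _ cg).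
  apply: (cvgr_gt _ c); rewrite gE det_mulmx det_tr; nra.
near=> u; split; last first.
  have /ltW h : (\det L / 2) ^+ 2 < \det (g u) by near: u.
  have := ler_wsqrtr h; rewrite sqrtr_sqr ger0_norm; last by rewrite divr_ge0// ltW.
  lra.
move=> w.
pose H := invmx L *m g u *m (invmx L)^T.
have gH : g u = L *m H *m L^T.
  rewrite /H trmx_inv !mulmxA mulmxV// mul1mx mulmxKV//.
  by rewrite unitmx_tr.
have H1 : H - 1%:M = invmx L *m (g u - g u0) *m (invmx L)^T.
  rewrite mulmxBr mulmxBl -/H gE !mulmxA mulVmx// mul1mx trmx_inv mulmxV//.
  by rewrite unitmx_tr.
have Hn : `|H - 1%:M| <= 1.
  have he : `|g u - g u0| <= e by rewrite distrC ltW//; near: u.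
  rewrite H1 (le_trans (norm_mulmx _ _))//.
  apply: (@le_trans _ _ (n%:R * (n%:R * (`|invmx L| * e) * `|(invmx L)^T|))).
    rewrite ler_wpM2l// ler_wpM2r// (le_trans (norm_mulmx _ _))//.
    by rewrite ler_wpM2l// ler_wpM2l.
  rewrite (_ : _ * _ = K * e); last by rewrite /K; ring.
  by rewrite /e ler_pdivrMr; lra.
have Hij i j : `|H i j| <= 2.
  have := le_trans (norm_mx_entry (H - 1%:M) i j) Hn.
  rewrite mxE [X in _ + X]mxE [X in _ - X]mxE => h.
  have := ler_normD (H i j - 1 *+ (i == j)) (1 *+ (i == j)); rewrite subrK.
  have : `|(1 : R) *+ (i == j)| <= 1 by case: (i == j); rewrite ?mulr1n ?mulr0n ?normr1 ?normr0.
  lra.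
have Hn2 : `|H| <= 2 by exact: norm_mx_le.
have -> : w *m g u *m w^T = (w *m L) *m H *m (w *m L)^T.
  by rewrite gH trmx_mul !mulmxA.
rewrite (le_trans (ler_norm _))// (le_trans (norm_mx_entry _ _ _))//.
rewrite (le_trans (norm_mulmx _ _))//.
have trn : `|(w *m L)^T| <= `|w *m L|.
  by apply: norm_mx_le => // i j; rewrite mxE norm_mx_entry.
have h := norm_mulmx (w *m L) H.
set W := `|w *m L| in trn h *.
have W0 : 0 <= W by exact: normr_ge0.
(* The entrywise estimates give [2 n^2 W^2], which is below [(2 n W)^2]. *)
apply: (@le_trans _ _ (n%:R * (n%:R * (W * 2) * W))).
  rewrite ler_wpM2l// ler_pM// (le_trans h)// ler_wpM2l// ler_wpM2l//.
have n0 : 0 <= n%:R :> R by [].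
have : 0 <= (n%:R * W) ^+ 2 by exact: sqr_ge0.
nra.
Unshelve. all: by end_near. Qed.

End MatrixNorm.

(** * The Riemannian distance *)

Section RiemannianDistance.
Context {R : realType} {n : nat} (M : closed_oriented_riemannian R n).

Let mu := (@lebesgue_measure R : {measure set _ -> \bar R}).

Lemma piece_length_ge0 (i : mfd_index M) (c : R -> 'rV[R]_n) : 0 <= piece_length i c.
Proof. by apply: Rintegral_ge0 => t _; exact: sqrtr_ge0. Qed.

Lemma path_length_ge0 (x y : M) L : path_length x y L -> 0 <= L.
Proof. by elim=> // i c z L' _ _ _ _ L0; rewrite addr_ge0// piece_length_ge0. Qed.

Lemma path_length_trans (x y z : M) L L' :
  path_length x y L -> path_length y z L' -> path_length x z (L + L').
Proof.
elim=> [w|i c w L1 dc cc ic _ IH] h; first by rewrite add0r.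
by rewrite -addrA; apply: path_cons => //; exact: IH.
Qed.

Lemma path_length_piece (i : mfd_index M) (c : R -> 'rV[R]_n) :
  (forall t, derivable c t 1) -> continuous (derive1 c) ->
  (forall t, 0 <= t <= 1 -> chart_img (mfd_chart i) (c t)) ->
  path_length (chart_inv (mfd_chart i) (c 0)) (chart_inv (mfd_chart i) (c 1)) (piece_length i c).
Proof.
by move=> dc cc ic; rewrite -[piece_length i c]addr0; apply: path_cons => //; exact: path_nil.
Qed.

Lemma gram_continuous (i : mfd_index M) u : chart_img (mfd_chart i) u ->
  {for u, continuous (mfd_gram i)}.
Proof. by move=> iu; have [] := mfd_gram_smooth [::] iu. Qed.

Lemma derive1_reverse (c : R -> 'rV[R]_n) (t : R) :
  (forall t, derivable c t 1) ->
  derivable (fun t : R => c (1 - t)) t 1 /\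
  derive1 (fun t : R => c (1 - t)) t = - derive1 c (1 - t).
Proof.
move=> dc.
pose f : R -> R := fun t => 1 - t.
have df : differentiable f t by [].
have dcf : differentiable c (f t) by apply/derivable1_diffP; exact: dc.
have dcomp : differentiable (c \o f) t by exact: differentiable_comp.
split; first by apply/derivable1_diffP; exact: dcomp.
rewrite (derive1E' dcomp) diff_comp//= (derive1E' dcf) -linearN; congr ('d c _ _).
rewrite -(derive1E' df) derive1E deriveB// derive_cst derive_id sub0r //.
Qed.

Lemma cvg_quadratic (T : Type) (F : set_system T) (v : T -> 'rV[R]_n) (g : T -> 'M[R]_n)
    (v0 : 'rV[R]_n) (g0 : 'M[R]_n) :
  Filter F -> v @ F --> v0 -> g @ F --> g0 ->
  (v x *m g x *m (v x)^T) 0 0 @[x --> F] --> (v0 *m g0 *m v0^T) 0 0.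
Proof.
move=> FF cv cg.
have E (w : 'rV[R]_n) (h : 'M[R]_n) :
    (w *m h *m w^T) 0 0 = \sum_k (\sum_l w 0 l * h l k) * w 0 k.
  by rewrite mxE; apply: eq_bigr => k _; rewrite !mxE.
rewrite E; under eq_cvg do rewrite E.
apply: cvg_big; first exact: add_continuous.
move=> k _; apply: cvgM; last exact: cvg_mx_entry.
apply: cvg_big; first exact: add_continuous.
by move=> l _; apply: cvgM; exact: cvg_mx_entry.
Qed.

(** Substitution [t |-> 1 - t], for which the speed has to be shown continuous; the sign of the
    derivative cancels in the quadratic form. *)
Lemma piece_length_reverse (i : mfd_index M) (c : R -> 'rV[R]_n) :
  (forall t, derivable c t 1) -> continuous (derive1 c) ->
  (forall t, 0 <= t <= 1 -> chart_img (mfd_chart i) (c t)) ->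
  piece_length i (fun t => c (1 - t)) = piece_length i c.
Proof.
move=> dc cc ic.
pose G t := Num.sqrt ((derive1 c t *m mfd_gram i (c t) *m (derive1 c t)^T) 0 0).
have cG : {within `[0, 1], continuous G}.
  apply: continuous_in_subspaceT => t; rewrite inE/= in_itv/= => t01.
  apply: (@cvg_comp _ _ _ (fun t => (derive1 c t *m mfd_gram i (c t) *m (derive1 c t)^T) 0 0)
    Num.sqrt _ _ _ _ (@sqrt_continuous R _)).
  apply: cvg_quadratic; first exact: cc.
  apply: (@cvg_comp _ _ _ c (mfd_gram i) _ (nbhs (c t)) _ _ (gram_continuous (ic t t01))).
  have ct : {for t, continuous c}.
    by apply: differentiable_continuous; apply/derivable1_diffP; exact: dc.
  exact: ct.
have h01 : 0 <= (1 : R) <= 1 by rewrite ler01 lexx.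
have E : \int[@lebesgue_measure R]_(t in `[0, 1]) G t =
    \int[@lebesgue_measure R]_(t in `[1 - 1, 1]) G (1 - t).
  exact: Rintegration_by_substitution_onem h01 cG.
rewrite subrr in E; rewrite [RHS]E.
apply: eq_Rintegral => t _.
have [_ ->] := derive1_reverse t dc.
by rewrite /G linearN/= mulNmx mulmxN mulNmx opprK.
Qed.

Lemma path_length_sym (x y : M) L : path_length x y L -> path_length y x L.
Proof.
elim=> [w|i c w L1 dc cc ic _ IH]; first exact: path_nil.
rewrite addrC; apply: path_length_trans IH _.
pose r (t : R) := c (1 - t).
rewrite -(piece_length_reverse dc cc ic).
have := @path_length_piece i r.
rewrite /r subr0 subrr; apply.
- by move=> t; have [] := derive1_reverse t dc.
- rewrite (_ : derive1 _ = fun t => - derive1 c (1 - t)); last first.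
    by apply/funext => t; have [] := derive1_reverse t dc.
  move=> t; apply: cvgN.
  have ct : (1 - s : R) @[s --> t] --> 1 - t by apply: cvgB; [exact: cvg_cst|exact: cvg_id].
  exact: (@cvg_comp _ _ _ (fun s : R => 1 - s) (derive1 c) _ _ _ ct (cc (1 - t))).
- by move=> t ht; apply: ic; lra.
Qed.

(** The norm bound controls distances from above and the determinant bound controls the volume
    density from below, both through one constant frame [L]. *)
Definition gram_bound (i : mfd_index M) (L : 'M[R]_n) (u : 'rV[R]_n) : Prop :=
  [/\ chart_img (mfd_chart i) u,
      forall w : 'rV[R]_n, (w *m mfd_gram i u *m w^T) 0 0 <= (2 * n%:R * `|w *m L|) ^+ 2
    & \det L <= 2 * Num.sqrt (\det (mfd_gram i u))].

Lemma near_gram_bound (i : mfd_index M) u0 : chart_img (mfd_chart i) u0 ->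
  exists2 L, upper_pos L & \forall u \near u0, gram_bound i L u.
Proof.
move=> iu; have [L Lu nL] :=
  near_gram (gram_continuous iu) (mfd_gram_sym iu) (mfd_gram_pos iu).
exists L => //.
have nU : \forall u \near u0, chart_img (mfd_chart i) u.
  by apply: open_nbhs_nbhs; split; [exact: chart_img_open|exact: iu].
by apply: filterS2 nU nL => u uU [].
Qed.

(** The straight segment stays in the box by convexity, and [gram_bound] limits its constant
    velocity [v - u] at every time. *)
Lemma segment_path (i : mfd_index M) L (q u v : 'rV[R]_n) r :
  (forall u, `|q - u| <= r -> gram_bound i L u) ->
  `|q - u| <= r -> `|q - v| <= r ->
  exists2 l, path_length (chart_inv (mfd_chart i) u) (chart_inv (mfd_chart i) v) l &
    l <= 2 * n%:R * `|(v - u) *m L|.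
Proof.
move=> gb uq vq.
pose c (t : R) := u + t *: (v - u).
have cl t : (fun h : R => h^-1 *: (c (h *: 1 + t) - c t)) @ 0^' --> v - u.
  apply: cvg_near_cst; near=> h.
  have h0 : h != 0 by near: h; exact: nbhs_dnbhs_neq.
  have -> : c (h *: 1 + t) - c t = h *: (v - u).
    by rewrite /c [h *: 1]mulr1 scalerDl; apply/rowP => k; rewrite !mxE; ring.
  by rewrite scalerA mulVf// scale1r.
have dc t : derivable c t 1 by apply/cvg_ex; exists (v - u); exact: cl.
have c1E t : derive1 c t = v - u by rewrite derive1E; apply/cvg_lim => //; exact: cl.
have cq t : 0 <= t <= 1 -> gram_bound i L (c t).
  move=> t01; apply: gb.
  have -> : q - c t = (1 - t) *: (q - u) + t *: (q - v).
    rewrite /c !scalerBr scalerBl scale1r; apply/rowP => k; rewrite !mxE; ring.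
  rewrite (le_trans (ler_normD _ _))// !normrZ.
  rewrite !ger0_norm; try lra.
  have := normr_ge0 (q - u); nra.
exists (piece_length i c).
  have c0 : c 0 = u by rewrite /c scale0r addr0.
  have c1 : c 1 = v by rewrite /c scale1r addrC subrK.
  have := @path_length_piece i c; rewrite c0 c1; apply.
  - exact: dc.
  - rewrite (_ : derive1 _ = fun=> v - u); last exact/funext.
    by move=> t; exact: cvg_cst.
  - by move=> t /cq[].
set K := 2 * _ * _.
have K0 : 0 <= K by rewrite !mulr_ge0.
(* The estimate is made for the extended real integral, by monotonicity; it also shows finiteness,
   which is needed to return to the real one. *)
set I := (\int[mu]_(t in `[0%R, 1%R]) (Num.sqrt
  ((derive1 c t *m mfd_gram i (c t) *m (derive1 c t)^T) 0 0))%:E)%E.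
have I0 : (0 <= I)%E by apply: integral_ge0 => t _; rewrite lee_fin sqrtr_ge0.
have IK : (I <= K%:E)%E.
  have <- : (\int[mu]_(t in `[0%R, 1%R]) (cst K%:E t) = K%:E)%E.
    rewrite integral_cst//= (_ : mu _ = 1%E) ?mule1//.
    apply: (etrans (lebesgue_measure_itv _)).
    by rewrite /= lte_fin ltr01 -EFinB subr0.
  rewrite /I integral_mkcond [leRHS]integral_mkcond.
  apply: le_integral_nonmeas => t; rewrite /patch; case: ifPn => //.
  rewrite inE/= in_itv/= => /cq[_ h _]; rewrite lee_fin c1E.
  by rewrite (le_trans (ler_wsqrtr (h _)))// sqrtr_sqr ger0_norm.
rewrite -lee_fin /piece_length /Rintegral -/I fineK//.
by rewrite ge0_fin_numE// (le_lt_trans IK)// ltry.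
Unshelve. all: by end_near. Qed.

(** Near [x], segments in one chart have length at most a constant times the coordinate distance.
    This gives both reachability of nearby points and continuity of the distance. *)
Lemma near_short_path (x : M) e : 0 < e ->
  \forall y \near x, exists2 l, path_length x y l & l < e.
Proof.
move=> e0; have [i ix] := mfd_cover x.
set u0 := chart_fun (mfd_chart i) x.
have iu : chart_img (mfd_chart i) u0 by exists x.
have [L Lu /nbhs_ballP[r /= r0 rL]] := near_gram_bound iu.
pose K := 2 * n%:R * (n%:R * `|L|) + 1.
have K0 : 0 < K by rewrite ltr_wpDl// !mulr_ge0.
have n1 : \forall y \near x, `|u0 - chart_fun (mfd_chart i) y| < Num.min (r / 2) (e / K).
  move/cvgrPdist_lt : (chart_fun_cont ix); apply.
  by rewrite lt_min !divr_gt0.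
have n2 : \forall y \near x, chart_dom (mfd_chart i) y.
  by apply: open_nbhs_nbhs; split; [exact: chart_dom_open|exact: ix].
apply: filterS2 n1 n2 => y; rewrite lt_min => /andP[y1 y2] iy.
have gb u : `|u0 - u| <= r / 2 -> gram_bound i L u.
  by move=> h; apply: rL; rewrite mx_norm_ball /ball_/=; lra.
have u00 : `|u0 - u0| <= r / 2 by rewrite subrr normr0 divr_ge0// ltW.
have [l] := segment_path gb u00 (ltW y1).
rewrite {1}/u0 !chart_funK// => pl hl; exists l => //.
apply: le_lt_trans hl _; rewrite -/u0.
set d := `|u0 - _| in y2.
apply: (@le_lt_trans _ _ (2 * n%:R * (n%:R * (d * `|L|)))).
  rewrite ler_wpM2l ?mulr_ge0// (le_trans (norm_mulmx _ _))//.
  by rewrite /d distrC.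
have d0 : 0 <= d by exact: normr_ge0.
apply: (@le_lt_trans _ _ (d * K)); first by rewrite /K; nra.
by move: y2; rewrite ltr_pdivlMr.
Qed.

(** The set of points reachable from [x] is open and closed, hence everything by connectedness. *)
Lemma path_exists (x y : M) : exists l, path_length x y l.
Proof.
pose A := [set y : M | exists l, path_length x y l].
suff : A = setT by move=> AT; have : A y by rewrite AT.
have oA : open A.
  rewrite openE => z [l pl]; have := near_short_path z ltr01.
  apply: filterS => w [l' pl' _]; exists (l + l'); exact: path_length_trans pl pl'.
have cA : closed A.
  rewrite -openC openE => z nz; have := near_short_path z ltr01.
  apply: filterS => w [l' pl' _] [l pl]; apply: nz; exists (l + l').
  exact: path_length_trans pl (path_length_sym pl').
apply: (@mfd_connected _ _ M).
- by exists x; exists 0; exact: path_nil.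
- by exists A => //; rewrite setTI.
- by exists A => //; rewrite setTI.
Qed.

Lemma riem_dist_le (x y : M) l : path_length x y l -> riem_dist x y <= l.
Proof.
move=> pl; apply: ge_inf => //.
by exists 0 => l' /path_length_ge0.
Qed.

(** The infima run over nonempty sets by [path_exists]; reversing and concatenating curves gives
    symmetry and the triangle inequality. *)
Lemma riem_dist_pseudometric : pseudometric (@riem_dist R n M).
Proof.
have lb (x y : M) b : (forall l, path_length x y l -> b <= l) -> b <= riem_dist x y.
  move=> h; apply: lb_le_inf; last exact: h.
  by have [l pl] := path_exists x y; exists l.
have d0 (x y : M) : 0 <= riem_dist x y by apply: lb => l /path_length_ge0.
have sym (x y : M) : riem_dist x y <= riem_dist y x.
  by apply: lb => l /path_length_sym; exact: riem_dist_le.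
split.
- by move=> x; apply/eqP; rewrite eq_le d0 andbT; apply: riem_dist_le; exact: path_nil.
- by move=> x y; apply/eqP; rewrite eq_le !sym.
- move=> y x z; rewrite -lerBlDr; apply: (lb) => l pl.
  rewrite lerBlDr addrC -lerBlDr; apply: lb => l' pl'.
  by rewrite lerBlDr addrC; apply: riem_dist_le; exact: path_length_trans pl pl'.
Qed.

Lemma near_riem_dist (x : M) e : 0 < e -> \forall y \near x, riem_dist x y < e.
Proof.
move=> e0; apply: filterS (near_short_path x e0) => y [l pl].
exact/le_lt_trans/riem_dist_le.
Qed.

Lemma riem_dist_box (i : mfd_index M) L (q u v : 'rV[R]_n) r :
  (forall u, `|q - u| <= r -> gram_bound i L u) ->
  `|q - u| <= r -> `|q - v| <= r ->
  riem_dist (chart_inv (mfd_chart i) u) (chart_inv (mfd_chart i) v) <=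
  2 * n%:R * `|(v - u) *m L|.
Proof.
move=> gb uq vq; have [l pl lb] := segment_path gb uq vq.
by rewrite (le_trans (riem_dist_le pl)).
Qed.


End RiemannianDistance.

(** * Coverings by small balls controlled by the volume *)

Section CellCover.
Context {R : realType}.

Definition ind (T : Type) (A : set T) (u : T) : \bar R := (\1_A u)%:E.

Lemma in_cell_norm n (L : 'M[R]_n) a h u v : 0 <= h ->
  in_cell L a h u -> in_cell L a h v -> `|(v - u) *m L| <= h.
Proof.
move=> h0 /forallP cu /forallP cv; apply: norm_mx_le => // i j.
rewrite mulmxBl !ord1 !mxE; have := cu j; have := cv j; rewrite !mxE.
by move=> ? ?; rewrite ler_norml; apply/andP; split; lra.
Qed.

Lemma norm_upper_pos n (L : 'M[R]_n) (w : 'rV[R]_n) : upper_pos L ->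
  `|w| <= n%:R * (`|w *m L| * `|invmx L|).
Proof.
move=> Lu; have Lunit : L \in unitmx by rewrite unitmxE unitfE gt_eqF// upper_pos_det.
by rewrite -{1}[w](mulmxK Lunit); exact: norm_mulmx.
Qed.

Section Grid.
Variables (n : nat) (L : 'M[R]_n) (b h : R) (T : nat).
Hypotheses (h0 : 0 < h) (hT : 2 * b < T%:R * h).

Definition corner (z : {ffun 'I_n -> 'I_T}) : 'rV[R]_n := \row_j (- b + (z j)%:R * h).

Lemma grid_cell u : `|u *m L| <= b -> exists z, in_cell L (corner z) h u.
Proof.
move=> ub.
have xj j : 0 <= ((u *m L) 0 j + b) / h < T%:R.
  have := le_trans (norm_mx_entry (u *m L) 0 j) ub; rewrite ler_norml => /andP[h1 h2].
  have hT' := hT; apply/andP; split; last by rewrite ltr_pdivrMr//; lra.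
  by rewrite divr_ge0 ?(ltW h0)//; lra.
have tj j : (Num.trunc (((u *m L) 0 j + b) / h)%R < T)%N.
  have /andP[x1 x2] := xj j; rewrite -(ltr_nat R); apply: le_lt_trans x2.
  by have /andP[] := truncn_itv x1.
exists [ffun j => Ordinal (tj j)]; apply/forallP => j.
have /andP[x1 x2] := xj j; have /andP[t1 t2] := truncn_itv x1.
rewrite mxE ffunE /=; set k := Num.trunc _ in t1 t2 *.
move: t1 t2; rewrite -[k.+1%:R]natr1 ler_pdivlMr// ltr_pdivrMr//.
set x := (u *m L) 0 j => t1 t2.
by apply/andP; split; lra.
Qed.

Lemma grid_cell_inj u z z' :
  in_cell L (corner z) h u -> in_cell L (corner z') h u -> z = z'.
Proof.
move=> /forallP c1 /forallP c2; apply/ffunP => j; apply/val_inj => /=.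
have := c1 j; have := c2 j; rewrite !mxE; set x := \sum_(_ < _) _.
move=> /andP[a1 a2] /andP[a3 a4].
have l1 : (z j)%:R * h < ((z' j).+1)%:R * h by rewrite -natr1; lra.
have l2 : (z' j)%:R * h < ((z j).+1)%:R * h by rewrite -natr1; lra.
move: l1 l2; rewrite !ltr_pM2r// !ltr_nat !ltnS => l1 l2.
by apply/eqP; rewrite eqn_leq l1 l2.
Qed.

End Grid.

(** Take the grid cells of side [h m] that meet [K]. As [K] is closed, the indicators of their
    unions converge to that of [K], dominated by one large cell, so the number of cells times
    [h^n / \det L] tends to the volume of [K]. One ball per cell covers [K]. *)
Lemma cell_cover n (L : 'M[R]_n) (K : set 'rV[R]_n) (B c delta eps : R)
    (X : eqType) (d : X -> X -> R) (phi : 'rV[R]_n -> X) :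
  upper_pos L -> closed K -> (forall u, K u -> `|u| <= B) -> 0 <= B ->
  0 < c -> 0 < delta -> 0 < eps ->
  (forall u v, K u -> K v -> d (phi u) (phi v) <= c * `|(v - u) *m L|) ->
  iter_integrable (ind K) /\
  exists s : seq (X * R), [/\ forall p, p \in s -> 0 < p.2 <= delta,
    ball_cover d s (phi @` K) &
    \sum_(p <- s) p.2 ^+ n <= (2 * c) ^+ n * \det L * fine (integral_rV (ind K)) + eps].
Proof.
move=> Lu cK KB B0 c0 dl0 e0 dK.
have dL := upper_pos_det Lu.
pose b := n%:R * (B * `|L|).
have b0 : 0 <= b by rewrite !mulr_ge0.
have Kb u : K u -> `|u *m L| <= b.
  move=> /KB uB; rewrite (le_trans (norm_mulmx _ _))//.
  by rewrite ler_wpM2l// ler_wpM2r.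
pose h (m : nat) : R := m.+1%:R^-1.
have h0 m : 0 < h m by rewrite invr_gt0.
have h1 m : h m <= 1 by rewrite invf_le1// ler1n.
(* Enough cells per coordinate to pass [b] strictly when starting from [-b], because cells are
   half-open. *)
pose T m := (Num.trunc (2 * b / h m)).+1.
have hT m : 2 * b < (T m)%:R * h m.
  rewrite -ltr_pdivrMr//; have x0 : 0 <= 2 * b / h m by rewrite divr_ge0 ?mulr_ge0// ltW.
  by have /andP[] := truncn_itv x0.
pose cl m (z : {ffun 'I_n -> 'I_(T m)}) := in_cell L (corner b (h m) z) (h m).
pose meets m z := `[< exists2 k, K k & cl m z k >].
pose S m := [seq z <- enum {: {ffun 'I_n -> 'I_(T m)}} | meets m z].
pose f m u : \bar R := (\sum_(z <- S m) (1 * (cl m z u)%:R)%:E)%E.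
have fi m : iter_integrable (f m) /\
    integral_rV (f m) = ((size (S m))%:R * (h m ^+ n / \det L))%:E.
  have I (z : {ffun 'I_n -> 'I_(T m)}) := @integral_cell R n L (corner b (h m) z) (h m) 1 Lu (ltW (h0 m)).
  have [i1 i2] := @iter_integrable_sum R n _ (S m) (fun z u => (1 * (cl m z u)%:R)%:E)
    (fun z => proj1 (I z)).
  split; first exact: i1.
  rewrite /f i2; under eq_bigr => z _ do rewrite (proj2 (I z)) mul1r.
  by rewrite sumEFin big_const_seq count_predT iter_addr_0 mulr_natl.
(* Distinct cells are disjoint, so the sum of their indicators is the indicator of their union. *)
have fE m u : f m u = ind [set u | exists2 z, z \in S m & cl m z u] u.
  rewrite /f /ind indicE sumEFin; congr (_%:E).
  case: (boolP (u \in _)) => [/set_mem[z zS zu]|/negP nu]; last first.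
    rewrite big_seq big1// => z zS; case: (boolP (cl m z u)) => zu; last by rewrite mulr0.
    by case: nu; apply/mem_set; exists z.
  rewrite (bigD1_seq z)//=; last by rewrite filter_uniq// enum_uniq.
  rewrite zu mulr1 big1 ?addr0// => z' z'z.
  case: (boolP (cl m z' u)) => z'u; last by rewrite mulr0.
  by move: z'z; rewrite (grid_cell_inj (h0 m) z'u zu) eqxx.
(* All cells meeting [K] satisfy [|(u L)_j| <= b + 1]; the dominating cell runs from [-(b + 1)] to
   [b + 2], with room for its open end. *)
pose G u : \bar R := (1 * (in_cell L (const_mx (- (b + 1))) (2 * b + 3) u)%:R)%:E.
have hb3 : 0 <= 2 * b + 3 by lra.
have [Gi _] := @integral_cell R n L (const_mx (- (b + 1))) (2 * b + 3) 1 Lu hb3.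
have near_K m u z : z \in S m -> cl m z u -> exists2 k, K k & `|(u - k) *m L| <= h m.
  rewrite mem_filter => /andP[/asboolP[k Kk zk] _] zu; exists k => //.
  exact: (in_cell_norm (ltW (h0 m)) zk zu).
have [Ki cI] : iter_integrable (ind K) /\
    (fun m => integral_rV (f m)) @ \oo --> integral_rV (ind K).
  apply: (@iter_dominated_convergence _ _ _ _ G) => //.
  - move=> m u; rewrite fE /ind indicE; case: (boolP (u \in _)) => [|_]; last first.
      by rewrite lexx /G mul1r lee_fin ler0n.
    move=> /set_mem[z zS zu]; rewrite lee_fin ler01 /=.
    have [k Kk uk] := near_K m u z zS zu.
    rewrite /G; suff -> : in_cell L (const_mx (- (b + 1))) (2 * b + 3) u by rewrite mulr1.
    apply/forallP => j; rewrite mxE.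
    have := le_trans (norm_mx_entry (k *m L) 0 j) (Kb k Kk).
    have := le_trans (norm_mx_entry ((u - k) *m L) 0 j) uk.
    have -> : ((u - k) *m L) 0 j = (u *m L) 0 j - (k *m L) 0 j.
      by rewrite mulmxBl mxE [X in _ + X]mxE.
    set y := (u *m L) 0 j; set y' := (k *m L) 0 j; rewrite !ler_norml.
    have := h1 m; move=> hm1 /andP[p1 p2] /andP[p3 p4].
    by apply/andP; split; lra.
  - by move=> m; have [] := fi m.
  (* The indicators are eventually constant at each [u]. Off [K], some ball around [u] misses [K],
     and small enough cells through [u] stay inside it. *)
  - move=> u; have [Ku|nKu] := pselect (K u).
      apply: cvg_near_cst; near=> m; rewrite fE /ind !indicE mem_set; last first.
        have [z zu] := grid_cell (h0 m) (hT m) (Kb u Ku).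
        exists z => //; rewrite mem_filter mem_enum andbT.
        by apply/asboolP; exists u.
      by rewrite mem_set.
    have : (~` K) u by [].
    move: cK; rewrite -openC openE => /(_ u)/[apply]/nbhs_ballP[r /= r0 ru].
    pose D := n%:R * `|invmx L| + 1.
    have D0 : 0 < D by rewrite ltr_wpDl// mulr_ge0.
    apply: cvg_near_cst; near=> m; rewrite fE /ind !indicE memNset; last first.
      move=> [z zS zu]; have [k Kk uk] := near_K m u z zS zu.
      have hr : h m < r / D.
        near: m; exact: (near_infty_natSinv_lt (PosNum (divr_gt0 r0 D0))).
      apply: (ru k) => //; rewrite mx_norm_ball /ball_ /=.
      rewrite (le_lt_trans (norm_upper_pos _ Lu))//.
      apply: (@le_lt_trans _ _ (h m * D)); last by rewrite -ltr_pdivlMr.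
      apply: (@le_trans _ _ (n%:R * (h m * `|invmx L|))).
        by rewrite ler_wpM2l// ler_wpM2r.
      by rewrite /D; have := h0 m; set y := `|invmx L|; nra.
    by rewrite memNset.
split=> //.
set IK := integral_rV (ind K) in cI *.
have IKfin : IK \is a fin_num by exact: integral_rV_fin.
pose A := (2 * c) ^+ n * \det L.
have A0 : 0 < A by rewrite mulr_gt0// exprn_gt0// mulr_gt0.
have cr : (fun m => (size (S m))%:R * (h m ^+ n / \det L)) @ \oo --> fine IK.
  have E : (fun m => (size (S m))%:R * (h m ^+ n / \det L)) =
      fine \o (fun m => integral_rV (f m)).
    by apply/funext => m /=; rewrite (proj2 (fi m)).
  by rewrite E; apply: fine_cvg; rewrite fineK.
have n1 : \forall m \near \oo, (size (S m))%:R * (h m ^+ n / \det L) < fine IK + eps / A.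
  by apply: (cvgr_lt _ cr); rewrite ltrDl divr_gt0.
have dc0 : 0 < delta / (2 * c) by rewrite divr_gt0// mulr_gt0.
have n2 : \forall m \near \oo, h m < delta / (2 * c).
  exact: (near_infty_natSinv_lt (PosNum dc0)).
have [m [m1 m2]] : exists m, (size (S m))%:R * (h m ^+ n / \det L) < fine IK + eps / A
    /\ h m < delta / (2 * c).
  by near \oo => m; exists m; split; near: m.
have kex z : exists k, meets m z -> K k /\ cl m z k.
  have [/asboolP[k Kk zk]|] := boolP (meets m z); first by exists k.
  by exists 0.
have [k hk] := choice kex.
(* Two points of a cell in [K] have images at distance at most [c * h m]; doubling the radius makes
   the inequality strict and accounts for the factor [(2 * c) ^+ n]. *)
exists [seq (phi (k z), 2 * c * h m) | z <- S m]; split.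
- move=> _ /mapP[z _ ->] /=; rewrite !mulr_gt0//=.
  by move: m2; rewrite ltr_pdivlMr ?mulr_gt0// mulrC => /ltW.
- move=> _ [u Ku <-].
  have [z zu] := grid_cell (h0 m) (hT m) (Kb u Ku).
  have zS : z \in S m by rewrite mem_filter mem_enum andbT; apply/asboolP; exists u.
  exists (phi (k z), 2 * c * h m); first by apply/mapP; exists z.
  move: zS; rewrite mem_filter => /andP[/hk[Kk zk] _].
  rewrite (le_lt_trans (dK _ _ Kk Ku))//=.
  have := in_cell_norm (ltW (h0 m)) zk zu; have := h0 m.
  set y := `|_|; nra.
- rewrite big_map/= big_const_seq count_predT iter_addr_0 -[leLHS]mulr_natl.
  move: m1; set x := (size _)%:R; rewrite mulrA ltr_pdivrMr// => hx.
  rewrite exprMn mulrCA.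
  apply: (@le_trans _ _ ((2 * c) ^+ n * ((fine IK + eps / A) * \det L))).
    by rewrite ler_wpM2l ?exprn_ge0 ?mulr_ge0 ?ltW.
  rewrite le_eqVlt; apply/orP; left; apply/eqP; rewrite /A; field.
  by rewrite !gt_eqF ?exprn_gt0 ?mulr_gt0.
Unshelve. all: by end_near. Qed.

End CellCover.

(** * Boxes and thin shells *)

Section Boxes.
Context {R : realType}.

Lemma upper_pos1 n : upper_pos (1%:M : 'M[R]_n).
Proof.
elim: n => [//|n IH] /=; have -> : (1%:M : 'M[R]_(1 + n)) = block_mx 1%:M 0 0 1%:M.
  by rewrite -scalar_mx_block.
by rewrite block_mxKdl block_mxKul block_mxKdr mxE eqxx; split.
Qed.

Definition shell n (q : 'rV[R]_n) (r t : R) : set 'rV[R]_n :=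
  [set u : 'rV[R]_n | `|q - u| <= r /\ r - t <= `|q - u|].

Lemma norm_dist_continuous n (q : 'rV[R]_n) : continuous (fun u : 'rV[R]_n => `|q - u|).
Proof.
move=> u; have c : (q - v) @[v --> u] --> q - u.
  exact: (@cvgB _ _ _ (nbhs u) _ (cst q) id q u (cvg_cst _) cvg_id).
exact: cvg_norm c.
Qed.

Lemma closed_cball n (q : 'rV[R]_n) r : closed [set u : 'rV[R]_n | `|q - u| <= r].
Proof.
apply: (@preimage_closed _ _ (fun u : 'rV[R]_n => `|q - u|) _ _ (@closed_le _ r)) => u _.
exact: norm_dist_continuous.
Qed.

Lemma open_cball n (q : 'rV[R]_n) r : open [set u : 'rV[R]_n | `|q - u| < r].
Proof.
apply: (@open_comp _ _ (fun u : 'rV[R]_n => `|q - u|) _ _ (@open_lt _ r)) => u _.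
exact: norm_dist_continuous.
Qed.

Lemma closed_shell n (q : 'rV[R]_n) r t : closed (shell q r t).
Proof.
apply: closedI; first exact: closed_cball.
apply: (@preimage_closed _ _ (fun u : 'rV[R]_n => `|q - u|) _ _ (@closed_ge _ (r - t))) => u _.
exact: norm_dist_continuous.
Qed.

(** The shell and the cube of half-side [r - 2 t] are disjoint and both lie in the cube of half-side
    [r + t]. The margins [t] allow for cubes being half-open; cubes are cells for the identity
    frame. *)
Lemma integral_shell n (q : 'rV[R]_n) (r t : R) : 0 < t -> 2 * t < r ->
  iter_integrable (ind (shell q r t)) ->
  (integral_rV (ind (shell q r t)) <=
    ((2 * (r + t)) ^+ n - (2 * (r - 2 * t)) ^+ n)%:E)%E.
Proof.
move=> t0 tr si.
have cellP (h : R) u : in_cell 1%:M (\row_j (q 0 j - h)) (2 * h) u =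
    [forall j, q 0 j - h <= u 0 j < q 0 j + h].
  by rewrite /in_cell mulmx1; apply: eq_forallb => j; rewrite mxE; congr andb; lra.
have h1 : 0 <= 2 * (r + t) by lra.
have h2 : 0 <= 2 * (r - 2 * t) by lra.
have [i1 e1] := integral_cell (\row_j (q 0 j - (r + t))) 1 (@upper_pos1 n) h1.
have [i2 e2] := integral_cell (\row_j (q 0 j - (r - 2 * t))) 1 (@upper_pos1 n) h2.
have [i3 e3] := iter_integrableD si i2.
rewrite det1 divr1 mul1r in e1; rewrite det1 divr1 mul1r in e2.
rewrite EFinB leeBrDr//; rewrite -e1 -e2 -e3.
apply: le_integral_rV => u.
  by rewrite adde_ge0// lee_fin// mul1r ler0n.
rewrite !mul1r -EFinD lee_fin indicE !cellP.
have outer : `|q - u| <= r ->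
    [forall j, q 0 j - (r + t) <= u 0 j < q 0 j + (r + t)].
  move=> ur; apply/forallP => j; have := le_trans (norm_mx_entry (q - u) 0 j) ur.
  by rewrite !mxE ler_norml => /andP[h3 h4]; apply/andP; split; lra.
have inner : [forall j, q 0 j - (r - 2 * t) <= u 0 j < q 0 j + (r - 2 * t)] ->
    `|q - u| <= r - 2 * t.
  move=> /forallP h; apply: norm_mx_le => [|i j]; first by lra.
  rewrite !ord1 !mxE; have /andP[h3 h4] := h j.
  by rewrite ler_norml; apply/andP; split; lra.
have [/set_mem[u1 u2]|_] := boolP (u \in shell q r t).
  rewrite outer// (_ : [forall j, _] = false) ?addr0//.
  by apply/negP => /inner; lra.
case: (boolP [forall j, q 0 j - (r - 2 * t) <= _ < _]) => [/inner ui|_]; last first.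
  by rewrite addr0 ler0n.
by rewrite outer ?add0r//; lra.
Qed.

(** The bound of [integral_shell] is continuous in [t] and vanishes at 0. Integrability remains a
    premise, to be supplied by [cell_cover] once [t] is chosen. *)
Lemma small_shell n (q : 'rV[R]_n) (r eps : R) : 0 < r -> 0 < eps ->
  exists t : R, [/\ 0 < t, 2 * t < r &
    iter_integrable (ind (shell q r t)) ->
    (integral_rV (ind (shell q r t)) <= eps%:E)%E].
Proof.
move=> r0 e0.
pose F (t : R) := (2 * (r + t)) ^+ n - (2 * (r - 2 * t)) ^+ n.
have cF : F t @[t --> 0] --> F 0.
  apply: cvgB; apply: (@cvg_comp _ _ _ _ (fun x : R => x ^+ n) _ _ _ _ (@exprn_continuous _ _ _)).
    by apply: cvgM; [exact: cvg_cst|apply: cvgD; [exact: cvg_cst|exact: cvg_id]].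
  apply: cvgM; first exact: cvg_cst.
  apply: cvgB; first exact: cvg_cst.
  by apply: cvgM; [exact: cvg_cst|exact: cvg_id].
have F0 : F 0 = 0 by rewrite /F mulr0 addr0 subr0 subrr.
rewrite F0 in cF.
have : \forall t \near (0 : R), F t < eps by exact: (cvgr_lt _ cF).
move=> /nbhs_ballP[d /= d0 dF].
pose t := Num.min (d / 2) (r / 3).
have t0 : 0 < t by rewrite lt_min !divr_gt0.
have t1 : t <= d / 2 by rewrite ge_min lexx.
have t2 : t <= r / 3 by rewrite ge_min lexx orbT.
have tr : 2 * t < r by lra.
exists t; split => // si; apply: le_trans (integral_shell t0 tr si) _.
rewrite lee_fin ltW//; apply: dF.
by rewrite /ball/= sub0r normrN gtr0_norm//; lra.
Qed.

End Boxes.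

(** * Covering a single chart *)

Section ChartCover.
Context {R : realType} {n : nat} (M : closed_oriented_riemannian R n).
Hypothesis n1 : (1 <= n)%N.

(** Boxes with rational centre and radius are enumerated; [good] selects those on which some frame
    satisfies [gram_bound]. *)
Lemma countable_boxes (i : mfd_index M) :
  exists (q : nat -> 'rV[R]_n) (r : nat -> R) (L : nat -> 'M[R]_n) (good : nat -> Prop),
    (forall j, good j -> [/\ 0 < r j, upper_pos (L j) &
       forall u, `|q j - u| <= r j -> gram_bound i (L j) u]) /\
    forall u, chart_img (mfd_chart i) u -> exists2 j, good j & `|q j - u| < r j.
Proof.
pose T : countType := ('rV[rat]_n * rat)%type.
pose box (x : T) (L : 'M[R]_n) := [/\ 0 < ratr x.2 :> R, upper_pos L &
  forall u, `|map_mx ratr x.1 - u| <= ratr x.2 -> gram_bound i L u].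
(* The default box has radius 0, so it is never good. *)
pose dflt : T := (0, 0).
pose x (j : nat) : T := odflt dflt (unpickle j).
have ex j : exists L, (exists L, box (x j) L) -> box (x j) L.
  have [[L b]|nb] := pselect (exists L, box (x j) L); first by exists L.
  by exists 0.
have [L hL] := choice ex.
exists (fun j => map_mx ratr (x j).1), (fun j => ratr (x j).2), L, (fun j => exists L, box (x j) L).
split=> [j /hL//|u iu].
have [L0 L0u /nbhs_ballP[e /= e0 eL]] := near_gram_bound iu.
(* Every point of a box of radius [rho] containing [u] is within [2 rho < e] of [u]. *)
have [rho /andP[rho0 rho1]] : exists rho : rat, 0 < (ratr rho : R) < e / 2.
  have e2 : 0 < e / 2 by rewrite divr_gt0.
  by have [rho] := rat_in_itvoo e2; rewrite in_itv/= => h; exists rho.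
have exq k : exists y : rat, `|ratr y - u 0 k| < ratr rho / 2.
  have lt : u 0 k - ratr rho / 2 < u 0 k + ratr rho / 2 by lra.
  have [y] := rat_in_itvoo lt; rewrite in_itv/= => /andP[h1 h2].
  by exists y; rewrite ltr_norml; apply/andP; split; lra.
have [y hy] := choice exq.
pose X : T := (\row_k y k, rho).
have xX : x (pickle X) = X by rewrite /x pickleK.
have qu : `|map_mx ratr X.1 - u| < ratr rho.
  apply: (@le_lt_trans _ _ (ratr rho / 2)); last by lra.
  apply: norm_mx_le => [|a k]; first by lra.
  by rewrite !mxE ord1 ltW.
exists (pickle X); rewrite xX//; exists L0; split=> // v hv.
apply: eL; rewrite mx_norm_ball /ball_ /=.
have -> : u - v = (map_mx ratr X.1 - v) - (map_mx ratr X.1 - u).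
  by rewrite opprB [RHS]addrC subrKA.
rewrite (le_lt_trans (ler_normB _ _))//; lra.
Qed.

Lemma sum_halves (e : R) J : 0 < e -> \sum_(j < J) e / 2 ^+ j.+1 <= e.
Proof.
move=> e0; suff -> : \sum_(j < J) e / 2 ^+ j.+1 = e - e / 2 ^+ J.
  by rewrite gerBl divr_ge0 ?exprn_ge0// ltW.
elim: J => [|J IH]; first by rewrite big_ord0 expr0 divr1 subrr.
rewrite big_ord_recr/= IH exprS; field.
by rewrite expf_neq0// pnatr_eq0.
Qed.

Definition density (i : mfd_index M) (u : 'rV[R]_n) : R := Num.sqrt (\det (mfd_gram i u)).

Let c : R := 2 * n%:R.
Let Q : R := (2 * c) ^+ n.

(* Countably many open boxes [B_j] cover the chart.  Removing from [W] and a
   slightly smaller concentric closed box the previous boxes [B_l], [l < j],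
   leaves disjoint closed sets [K_j], to which [cell_cover] applies; what is
   missed lies in thin shells, whose covers cost at most [eps / 2^(j+1)]. *)
Lemma chart_cover (i : mfd_index M) (A : set M) (delta eps : R) :
  open A -> 0 < delta -> 0 < eps ->
  let W := chart_fun (mfd_chart i) @` (chart_dom (mfd_chart i) `\` A) in
  exists s : nat -> seq (M * R), [/\ forall j p, p \in s j -> 0 < p.2 <= delta,
    forall x, chart_dom (mfd_chart i) x -> ~ A x ->
      exists j, exists2 p, p \in s j & riem_dist p.1 x < p.2 &
    forall J, ((\sum_(j < J) \sum_(p <- s j) p.2 ^+ n)%:E <=
      (2 * Q)%:E * integral_rV ((fun u => (density i u)%:E) \_ W) + eps%:E)%E].
Proof.
move=> oA dl0 e0 W.
have c0 : 0 < c by rewrite mulr_gt0// ltr0n.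
have Q0 : 0 < Q by rewrite exprn_gt0// mulr_gt0.
have [q [r [L [good [gP gcov]]]]] := countable_boxes i.
pose ch := mfd_chart i.
pose early j u := forall l, (l < j)%N -> good l -> ~ (`|q l - u| < r l).
have key j : exists X : seq (M * R) * set 'rV[R]_n * R, let: (s, K, a) := X in
  [/\ forall p, p \in s -> 0 < p.2 <= delta,
      good j -> forall u, `|q j - u| < r j -> W u -> early j u ->
        exists2 p, p \in s & riem_dist p.1 (chart_inv ch u) < p.2,
      iter_integrable (ind K) /\
        \sum_(p <- s) p.2 ^+ n <= 2 * Q * (a * fine (integral_rV (ind K))) + eps / 2 ^+ j.+1 &
      0 <= a /\ forall u, K u -> [/\ W u, good j, `|q j - u| < r j, early j u & a <= density i u]].
  have ej0 : 0 < eps / 2 ^+ j.+1 by rewrite divr_gt0// exprn_gt0.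
  set ej := eps / _ in ej0 *.
  have [gj|ngj] := pselect (good j); last first.
    exists ([::], set0, 0); split => //.
    rewrite big_nil mul0r mulr0 add0r ltW//; split => //.
    rewrite (_ : ind set0 = cst 0%E); first exact: iter_integrable0.
    by apply/funext => u; rewrite /ind indicE memNset.
  have [rj0 Lj gb] := gP j gj.
  have dL := upper_pos_det Lj.
  set qj := q j in gb *; set rj := r j in gb rj0 *; set Lj' := L j in gb Lj dL *.
  have dist u v : `|qj - u| <= rj -> `|qj - v| <= rj ->
    riem_dist (chart_inv ch u) (chart_inv ch v) <= c * `|(v - u) *m Lj'|.
    by move=> hu hv; exact: (riem_dist_box gb).
  (* The error [ej] is split in thirds: the volume of the shell, and the errors of [cell_cover] for
     the shell and for [K]. *)
  have e3 : 0 < ej / (3 * (Q * \det Lj')) by rewrite divr_gt0// mulr_gt0// mulr_gt0.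
  have [t [t0 tr small]] := small_shell qj rj0 e3.
  pose B := `|qj| + rj.
  have B0 : 0 <= B by rewrite addr_ge0// ltW.
  have inB u : `|qj - u| <= rj -> `|u| <= B.
    move=> hu; have -> : u = qj - (qj - u) by rewrite opprB addrC subrK.
    by rewrite (le_trans (ler_normB _ _))// lerD2l.
  have ej3 : 0 < ej / 3 by rewrite divr_gt0.
  have [||iS [sS [sS1 sS2 sS3]]] := @cell_cover R n Lj' (shell qj rj t) B c delta (ej / 3)
    M (@riem_dist R n M) (chart_inv ch) Lj (@closed_shell R n qj rj t) _ B0 c0 dl0 ej3.
  - by move=> u [hu _]; exact: inB.
  - by move=> u v [hu _] [hv _]; exact: dist.
  (* [A] is removed only within the chart image, where its preimage is open by continuity of
     [chart_inv]; this makes [K] closed. *)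
  pose K : set 'rV[R]_n := [set u | [/\ `|qj - u| <= rj - t,
    ~ (chart_img ch u /\ A (chart_inv ch u)) & early j u]].
  have KW u : K u -> W u.
    move=> [h1 h2 _]; have [] := gb u; first by lra.
    move=> [x ix xu] _ _; exists x => //; split=> // Ax; apply: h2.
    by split; [exists x|rewrite -xu chart_funK].
  have cK : closed K.
    have -> : K = [set u | `|qj - u| <= rj - t] `&`
        (~` [set u | chart_img ch u /\ A (chart_inv ch u)] `&`
         \bigcap_(l in [set l | (l < j)%N /\ good l]) ~` [set u | `|q l - u| < r l]).
      apply/seteqP; split=> u.
        by move=> [h1 h2 h3]; split => //; split => // l [lj gl]; exact: h3.
      by move=> [h1 [h2 h3]]; split => // l lj gl; exact: h3.
    apply: closedI; first exact: closed_cball.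
    apply: closedI.
      rewrite closedC openE => u [iu Au].
      have nU : \forall u \near u, chart_img ch u.
        by apply: open_nbhs_nbhs; split; [exact: chart_img_open|exact: iu].
      have nA : \forall u \near u, A (chart_inv ch u).
        by apply: (chart_inv_cont iu); apply: open_nbhs_nbhs; split.
      by apply: filterS2 nU nA => v.
    by apply: closed_bigI => l _; rewrite closedC; exact: open_cball.
  have [||iK [sK [sK1 sK2 sK3]]] := @cell_cover R n Lj' K B c delta (ej / 3)
    M (@riem_dist R n M) (chart_inv ch) Lj cK _ B0 c0 dl0 ej3.
  - by move=> u [hu _ _]; apply: inB; lra.
  - by move=> u v [hu _ _] [hv _ _]; apply: dist; lra.
  (* By [gram_bound], [\det Lj' / 2] bounds the density below on the box; halving is what turns [Q]
     into [2 * Q]. *)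
  exists (sK ++ sS, K, \det Lj' / 2); split.
  - by move=> p; rewrite mem_cat => /orP[/sK1|/sS1].
  - move=> _ u uj Wu eu; have [ut|tu] := leP (`|qj - u|) (rj - t).
      have [|p ps pd] := sK2 (chart_inv ch u).
        exists u => //; split=> //; move: Wu => [x [ix nAx] xu] [_].
        by rewrite -xu chart_funK.
      by exists p => //; rewrite mem_cat ps.
    have [|p ps pd] := sS2 (chart_inv ch u).
      by exists u => //; split; rewrite ltW.
    by exists p => //; rewrite mem_cat ps orbT.
  - split=> //; rewrite big_cat/= -/Q in sK3 sS3 *.
    have fS : fine (integral_rV (ind (shell qj rj t))) <= ej / (3 * (Q * \det Lj')).
      by rewrite -lee_fin fineK; [exact: small|exact: integral_rV_fin].
    have : Q * \det Lj' * fine (integral_rV (ind (shell qj rj t))) <= ej / 3.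
      rewrite -ler_pdivlMl ?mulr_gt0// (le_trans fS)// le_eqVlt; apply/orP; left.
      by apply/eqP; field; rewrite !gt_eqF.
    rewrite (_ : 2 * Q * (\det Lj' / 2 * _) = Q * \det Lj' * fine (integral_rV (ind K))); last first.
      by field.
    lra.
  - split; first by rewrite divr_ge0// ltW.
    move=> u Ku; have [h1 h2 h3] := Ku; split=> //; [exact: KW|lra|].
    have [|_ _] := gb u; first by lra.
    by rewrite /density; lra.
have [X hX] := choice key.
pose s j := (X j).1.1; pose K j := (X j).1.2; pose a j := (X j).2.
have {}hX j : [/\ forall p, p \in s j -> 0 < p.2 <= delta,
      good j -> forall u, `|q j - u| < r j -> W u -> early j u ->
        exists2 p, p \in s j & riem_dist p.1 (chart_inv ch u) < p.2,
      iter_integrable (ind (K j)) /\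
        \sum_(p <- s j) p.2 ^+ n <= 2 * Q * (a j * fine (integral_rV (ind (K j)))) + eps / 2 ^+ j.+1 &
      0 <= a j /\ forall u, K j u -> [/\ W u, good j, `|q j - u| < r j, early j u & a j <= density i u]].
  by have := hX j; rewrite /s /K /a; case: (X j) => [[]].
exists s; split.
- by move=> j p; have [h _ _ _] := hX j; exact: h.
- move=> x ix nAx.
  pose P j := `[< good j /\ `|q j - chart_fun ch x| < r j >].
  have exP : exists j, P j.
    have [|j gj jx] := gcov (chart_fun ch x); first by exists x.
    by exists j; apply/asboolP.
  (* The first good box containing the point is the one for which the point is [early]. *)
  case: (ex_minnP exP) => j /asboolP[gj jx] jmin.
  have [_ /(_ gj (chart_fun ch x) jx) + _ _] := hX j.
  rewrite chart_funK// => h; exists j; apply: h; first by exists x.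
  move=> l lj gl lx; have : P l by apply/asboolP.
  by move/jmin; rewrite leqNgt lj.
move=> J.
(* The sets [K j] are disjoint, since a point is early for one good box only; hence the step
   function with values [a j] lies below the density on [W]. *)
have sumK : (\sum_(j < J) (a j)%:E * integral_rV (ind (K j)) <=
    integral_rV ((fun u => (density i u)%:E) \_ W))%E.
  have iaK j := iter_integrableZ (a j) (proj1 (let: And4 _ _ h _ := hX j in h)).
  under eq_bigr => j _ do rewrite -(proj2 (iaK j)).
  have [_ <-] := @iter_integrable_sum R n _ (index_enum 'I_J)
    (fun j : 'I_J => fun u => ((a j)%:E * ind (K j) u)%E) (fun j => proj1 (iaK j)).
  have a0 j : 0 <= a j by have [_ _ _ []] := hX j.
  apply: le_integral_rV => u.
    by apply: sume_ge0 => j _; rewrite mule_ge0 ?lee_fin ?a0.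
  have [[j Kju]|nK] := pselect (exists j : 'I_J, K j u).
    rewrite (bigD1 j)//= big1 ?adde0; last first.
      move=> l lj; rewrite /ind indicE memNset ?mule0// => Klu.
      have [_ _ _ [_ /(_ _ Kju)[_ gj jr ej _]]] := hX j.
      have [_ _ _ [_ /(_ _ Klu)[_ gl lr el _]]] := hX l.
      have : (j : nat) != l by rewrite eq_sym.
      rewrite neq_ltn => /orP[jl|jl]; first exact: (el j jl gj jr).
      exact: (ej l jl gl lr).
    have [_ _ _ [_ /(_ _ Kju)[Wu _ _ _ ad]]] := hX j.
    by rewrite /ind indicE !mem_set// mule1 /patch mem_set// lee_fin.
  rewrite big1 => [|j _].
    by rewrite /patch; case: ifPn => // _; rewrite lee_fin sqrtr_ge0.
  by rewrite /ind indicE memNset ?mule0// => Kju; apply: nK; exists j.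
apply: (@le_trans _ _ (((2 * Q)%:E * \sum_(j < J) (a j)%:E * integral_rV (ind (K j))) + eps%:E)%E); last first.
  by rewrite leeD2r// lee_pmul2l// lte_fin mulr_gt0.
have -> : (\sum_(j < J) (a j)%:E * integral_rV (ind (K j)) =
    (\sum_(j < J) a j * fine (integral_rV (ind (K j))))%:E)%E.
  rewrite -sumEFin; apply: eq_bigr => j _; rewrite EFinM fineK//.
  by apply: integral_rV_fin; have [_ _ []] := hX j.
rewrite -EFinM -EFinD lee_fin mulr_sumr.
apply: (@le_trans _ _ (\sum_(j < J) (2 * Q * (a j * fine (integral_rV (ind (K j)))) + eps / 2 ^+ j.+1))).
  by apply: ler_sum => j _; have [_ _ []] := hX j.
by rewrite big_split/= lerD2l; exact: sum_halves.
Qed.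

End ChartCover.

(* [compact_cover] is stated for pointed types only. *)
Lemma compact_cover_compact (T : topologicalType) (x0 : T) :
  compact [set: T] -> cover_compact [set: T].
Proof.
pose pT : ptopologicalType := HB.pack_for ptopologicalType T (isPointed.Build T x0).
by move=> cT; have : @compact pT setT := cT; rewrite compact_cover.
Qed.

(** * Covering the whole manifold *)

Section VolumeCover.
Context {R : realType} {n : nat} (M : closed_oriented_riemannian R n).
Hypothesis n1 : (1 <= n)%N.

Let Q : R := (2 * (2 * n%:R)) ^+ n.

Lemma density_ge0 (i : mfd_index M) W u : (0 <= ((fun u => (density i u)%:E) \_ W) u)%E.
Proof. by rewrite /patch; case: ifPn => // _; rewrite lee_fin sqrtr_ge0. Qed.

(** Induction along the recursion of [vol_along]: each chart takes half of the remaining error and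
    adds its open domain to [A]. The covers are countable, hence the bound on all partial sums. *)
Lemma vol_along_cover (s : seq (mfd_index M)) (A : set M) (delta eps : R) :
  open A -> 0 < delta -> 0 < eps ->
  exists F : nat -> seq (M * R), [/\ forall j p, p \in F j -> 0 < p.2 <= delta,
    forall x, foldr (fun i P => chart_dom (mfd_chart i) x \/ P) False s -> ~ A x ->
      exists j, exists2 p, p \in F j & riem_dist p.1 x < p.2 &
    forall J, ((\sum_(j < J) \sum_(p <- F j) p.2 ^+ n)%:E <=
      (2 * Q)%:E * vol_along A s + eps%:E)%E].
Proof.
move=> oA dl0; elim: s A oA eps => [|i s IH] A oA eps e0.
  exists (fun=> [::]); split => //= J; rewrite mule0 add0e lee_fin big1 ?ltW// => j _.
  by rewrite big_nil.
have e2 : 0 < eps / 2 by rewrite divr_gt0.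
have [F1 [r1 c1 v1]] := chart_cover n1 i oA dl0 e2.
have [|F2 [r2 c2 v2]] := IH (A `|` chart_dom (mfd_chart i)) _ _ e2.
  by apply: openU => //; exact: chart_dom_open.
exists (fun j => F1 j ++ F2 j); split.
- by move=> j p; rewrite mem_cat => /orP[/r1|/r2].
- move=> x /= hx nAx; have [ix|nix] := pselect (chart_dom (mfd_chart i) x).
    have [j [p pF pd]] := c1 x ix nAx.
    by exists j, p => //; rewrite mem_cat pF.
  have [//||j [p pF pd]] := c2 x.
  - by case: hx.
  - by case.
  by exists j, p => //; rewrite mem_cat pF orbT.
- move=> J; under eq_bigr do rewrite big_cat/=.
  rewrite big_split/= EFinD.
  apply: le_trans (leeD (v1 J) (v2 J)) _.
  have W0 : (0 <= integral_rV ((fun u => (density i u)%:E) \_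
      (chart_fun (mfd_chart i) @` (chart_dom (mfd_chart i) `\` A))))%E.
    by apply: integral_rV_ge0 => u; exact: density_ge0.
  have V0 : forall B, (0 <= vol_along B s)%E.
    elim: (s) => [//|k s' IH'] B /=; rewrite adde_ge0//.
    by apply: integral_rV_ge0 => u; exact: density_ge0.
  rewrite addeACA -EFinD -splitr leeD2r//.
  by rewrite -ge0_muleDr.
Qed.

Lemma open_riem_ball (x : M) e : open [set y | riem_dist x y < e].
Proof.
have dP := riem_dist_pseudometric M.
rewrite openE => y /= xy; have h : 0 < e - riem_dist x y by rewrite subr_gt0.
apply: filterS (near_riem_dist y h) => z; rewrite ltrBrDl.
exact/le_lt_trans/(pdist_tri dP).
Qed.

(** Compactness is used twice: for a finite list of charts covering [M], then to keep finitely many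
    of the countably many families of balls. [riem_vol], a supremum, bounds the volume along the
    list. *)
Lemma riem_vol_cover (delta eps : R) : 0 < delta -> 0 < eps ->
  exists s : seq (M * R), [/\ forall p, p \in s -> 0 < p.2 <= delta,
    ball_cover (@riem_dist R n M) s setT &
    ((\sum_(p <- s) p.2 ^+ n)%:E <= (2 * Q)%:E * riem_vol M + eps%:E)%E].
Proof.
move=> dl0 e0.
have [idx idxP] := choice (@mfd_cover R n M).
have [x0 _] := mfd_nonempty M.
have cM := compact_cover_compact x0 (@mfd_compact _ _ M).
have [||D _ Dc] := cM M setT (fun x => chart_dom (mfd_chart (idx x))).
- by move=> x _; exact: chart_dom_open.
- by move=> x _; exists x => //; exact: idxP.
pose l := [seq idx x | x <- finmap.enum_fset D].
have [F [rF cF vF]] := vol_along_cover l open0 dl0 e0.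
have [||E _ Ec] := cM nat setT (fun j => [set x | exists2 p, p \in F j & riem_dist p.1 x < p.2]).
- move=> j _; rewrite openE => x [p pF px].
  have : open [set y | riem_dist p.1 y < p.2] by exact: open_riem_ball.
  rewrite openE => /(_ x px); apply: filterS => y py.
  by exists p.
- move=> x _; have [|//|j [p pF px]] := cF x; last by exists j => //; exists p.
  have [y yD xy] := Dc x I; rewrite /l.
  have {yD} : y \in finmap.enum_fset D by exact: yD.
  elim: (finmap.enum_fset D) => //= z S IH; rewrite in_cons => /orP[/eqP<-|/IH]; first by left.
  by right.
pose J := (\max_(j <- finmap.enum_fset E) j).+1.
exists (flatten [seq F j | j <- iota 0 J]); split.
- by move=> p /flattenP[_ /mapP[j _ ->]]; exact: rF.
- move=> x _; have [j jE [p pF px]] := Ec x I.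
  exists p => //; apply/flattenP; exists (F j) => //; apply/mapP; exists j => //.
  rewrite mem_iota/= add0n ltnS.
  exact: (@leq_bigmax_seq _ _ _ id).
- rewrite big_flatten big_map -[iota 0 J]/(index_iota 0 J) big_mkord.
  apply: le_trans (vF J) _; rewrite leeD2r// lee_pmul2l//.
    by apply: ereal_sup_ubound; exists l.
  by rewrite lte_fin mulr_gt0// exprn_gt0// !mulr_gt0// ltr0n.
Qed.

End VolumeCover.

(** * Volume bounds *)

(* The bound of [tetrahedral_annulus] between the radii [r / 8] and [r / 4]: these
   annuli are disjoint around [r]-separated points, even after thickening. *)
Definition annulus_content {R : realType} (n : nat) (alpha beta r : R) : R :=
  ((beta - alpha) * (r / 8)) ^+ n.-1 * (r / 8).

(** The factor [2 ^+ n] comes from [tetrahedral_packing], the remaining one from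
    [riem_vol_cover]. *)
Definition packing_const (R : realType) (n : nat) : R :=
  2 ^+ n * (2 * (2 * (2 * n%:R)) ^+ n).

Section VolumePacking.
Context {R : realType} {n : nat} (M : closed_oriented_riemannian R n).
Variables (r0 alpha beta C V0 : R).
Hypotheses (n1 : (1 <= n)%N) (hr0 : 0 < r0) (ab : alpha < beta) (C0 : 0 < C).
Hypothesis tet : forall r : R, 0 < r -> r <= r0 ->
  tetrahedral (@riem_dist R n M) n C alpha beta r.

Local Notation content := (annulus_content n alpha beta).
Local Notation P := (packing_const R n).

Lemma annulus_content_gt0 r : 0 < r -> 0 < content r.
Proof.
move=> rp; have r8 : 0 < r / 8 by rewrite divr_gt0.
by rewrite mulr_gt0// exprn_gt0// mulr_gt0// subr_gt0.
Qed.

Lemma packing_const_gt0 : 0 < P.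
Proof. by rewrite !(mulr_gt0, exprn_gt0)// ltr0n. Qed.

Lemma volume_packing (r : R) (N : nat) (x : 'I_N -> M) : 0 < r -> r <= r0 ->
  (forall i j, i != j -> r <= riem_dist (x i) (x j)) ->
  ((N%:R * content r)%:E <= P%:E * riem_vol M)%E.
Proof.
move=> rp rr0 sep; apply/lee_addgt0Pr => e e0.
have e2 : 0 < e / 2 ^+ n by rewrite divr_gt0// exprn_gt0.
have r8 : 0 < r / 8 by rewrite divr_gt0.
have [s [s1 s2 s3]] := riem_vol_cover M n1 r8 e2.
have := tetrahedral_packing (riem_dist_pseudometric M) n1 C0 ab rp rr0 (lexx _)
  (fun t t0 tr => @tet t t0 tr) s1 s2 sep.
rewrite -/(content r) -lee_fin => /le_trans; apply.
have p2 : 0 < 2 ^+ n :> R by rewrite exprn_gt0.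
have vol0 : (0 <= riem_vol M)%E by apply: ereal_sup_ubound; exists [::].
rewrite EFinM; apply: le_trans (lee_wpmul2l _ s3) _; first by rewrite lee_fin ltW.
have Q0 : 0 <= 2 * (2 * (2 * n%:R)) ^+ n :> R by rewrite mulr_ge0// exprn_ge0// !mulr_ge0.
rewrite ge0_muleDr; [|by rewrite mule_ge0 ?lee_fin|by rewrite lee_fin ltW].
by rewrite muleA -!EFinM -/(packing_const R n) mulrCA divff ?mulr1// gt_eqF.
Qed.

(** A single point is vacuously separated, so [volume_packing] applies with [N = 1] at radius
    [r0]. *)
Lemma riem_vol_ge : ((content r0 / P)%:E <= riem_vol M)%E.
Proof.
have P0 := packing_const_gt0.
have [x _] := mfd_nonempty M.
have := @volume_packing r0 1 (fun=> x) hr0 (lexx _); rewrite mul1r => H.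
have {}H : ((content r0)%:E <= P%:E * riem_vol M)%E.
  by apply: H => i j; rewrite !ord1 eqxx.
by rewrite mulrC EFinM lee_pdivrMl// -lte_fin.
Qed.

Hypothesis vol : (riem_vol M <= V0%:E)%E.

Lemma packing_bound (r : R) (N : nat) (x : nat -> M) : 0 < r -> r <= r0 ->
  (forall i j, (i < j)%N -> (j < N)%N -> r <= riem_dist (x i) (x j)) ->
  N%:R <= P * V0 / content r.
Proof.
move=> rp rr0 sep; rewrite ler_pdivlMr ?annulus_content_gt0//.
rewrite -lee_fin; apply: (le_trans (@volume_packing r N (fun i => x i) rp rr0 _)).
  move=> i j ij; have : (i : nat) != j by [].
  rewrite neq_ltn => /orP[|] h; first exact: sep.
  by rewrite (pdist_sym (riem_dist_pseudometric M)); exact: sep.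
rewrite EFinM; apply: (lee_wpmul2l _ vol).
by rewrite lee_fin ltW// packing_const_gt0.
Qed.

(** If [t] were not attained, the open ball of radius [t] around [x] would also be closed, hence all
    of [M], although it misses [z]. *)
Lemma exists_at_distance (x z : M) (t : R) : 0 <= t <= riem_dist x z ->
  exists y, riem_dist x y = t.
Proof.
have dP := riem_dist_pseudometric M.
move=> /andP[t0 tz]; apply: contrapT => nt.
have ne y : riem_dist x y != t by apply/eqP => e; apply: nt; exists y.
pose A : set M := [set y | riem_dist x y < t].
have oA : open A by exact: open_riem_ball.
have AE : A = ~` [set y | t < riem_dist x y].
  apply/seteqP; split=> y /=; first by move=> h /(lt_trans h); rewrite ltxx.
  by move/negP; rewrite -leNgt le_eqVlt (negbTE (ne y)).
have cA : closed A.
  rewrite AE closedC openE => y /= ty.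
  have h : 0 < riem_dist x y - t by rewrite subr_gt0.
  apply: filterS (near_riem_dist y h) => w yw /=.
  have := pdist_tri dP w x y; rewrite (pdist_sym dP w y); lra.
have AT : A = setT.
  apply: (@mfd_connected _ _ M).
  - by exists x; rewrite /A/= lt_neqAle ne (pdistxx dP).
  - by exists A => //; rewrite setTI.
  - by exists A => //; rewrite setTI.
have : A z by rewrite AT.
by rewrite /A/= ltNge tz.
Qed.

(** If [z] were farther away, there would be points at distance [k * r0] from [x] for
    [k = 0, ..., T] with [T] the integer part of [K]. They are [r0]-separated and number
    [T + 1 > K], against [packing_bound]. *)
Lemma riem_dist_bound (x z : M) :
  riem_dist x z <= (P * V0 / content r0 + 1) * r0.
Proof.
have dP := riem_dist_pseudometric M.
set K := P * V0 / content r0.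
have V00 : 0 <= V0.
  by rewrite -lee_fin; apply: le_trans vol; apply: ereal_sup_ubound; exists [::].
have K0 : 0 <= K.
  have /ltW a0 := annulus_content_gt0 hr0; have /ltW p0 := packing_const_gt0.
  by rewrite divr_ge0// mulr_ge0.
rewrite leNgt; apply/negP => xz.
have ey (k : nat) : exists y, (k%:R <= K + 1) -> riem_dist x y = k%:R * r0.
  have [kK|nk] := pselect (k%:R <= K + 1); last by exists x.
  have [|y xy] := @exists_at_distance x z (k%:R * r0); last by exists y.
  have r0W := ltW hr0.
  by rewrite mulr_ge0//= (le_trans _ (ltW xz))// ler_wpM2r.
have [y hy] := choice ey.
have /andP[T1 T2] := truncn_itv K0; set T := Num.trunc K in T1 T2.
suff : T.+1%:R <= K by rewrite leNgt T2.
apply: (@packing_bound r0 _ y) => // i j ij; rewrite ltnS => jT.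
have jK : j%:R <= K + 1 by rewrite (le_trans _ (ler_wpDr _ T1))// ler_nat.
have iK : i%:R <= K + 1 by rewrite (le_trans _ jK)// ler_nat ltnW.
have := pdist_tri dP (y i) x (y j); rewrite (hy _ jK) (hy _ iK).
have : i%:R + 1 <= j%:R :> R by rewrite natr1 ler_nat.
have := hr0; nra.
Qed.

End VolumePacking.

(** * Nets from maximal separated families *)

Section Nets.
Context {R : realType} {X : Type} (d : X -> X -> R).

(** A separated family of maximal size is a net: a point far from all its members could be added. *)
Lemma net_of_packing (r : R) (N : nat) (x0 : X) : pseudometric d -> 0 < r ->
  (forall m (x : nat -> X),
    (forall i j, (i < j)%N -> (j < m)%N -> r <= d (x i) (x j)) -> (m <= N)%N) ->
  exists f : nat -> X, forall y, exists2 k, (k < N)%N & d y (f k) < r.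
Proof.
move=> dP r0 pack.
pose P m := `[< exists x : nat -> X,
  forall i j, (i < j)%N -> (j < m)%N -> r <= d (x i) (x j) >].
have exP : exists m, P m by exists 0%N; apply/asboolP; exists (fun=> x0).
have bP m : P m -> (m <= N)%N by move=> /asboolP[x hx]; exact: pack hx.
case: (ex_maxnP exP bP) => m /asboolP[x hx] mmax.
exists x => y; apply: contrapT => ny.
suff /mmax : P m.+1 by rewrite ltnn.
apply/asboolP; exists (fun i => if i == m then y else x i) => i j ij.
rewrite ltnS leq_eqVlt => /orP[/eqP jm|jm].
  rewrite jm in ij *; rewrite eqxx (ltn_eqF ij) leNgt (pdist_sym dP).
  apply/negP => yi; apply: ny; exists i => //; apply: (leq_trans ij).
  by apply: bP; apply/asboolP; exists x.
by rewrite !ltn_eqF ?hx// (ltn_trans ij).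
Qed.

End Nets.

(** * Gromov-Hausdorff precompactness *)

Section MetricQuotient.
Context {R : realType} {T : Type} {d : T -> T -> R}.

(* The metric space associated with a pseudometric: the class of [t] is
   represented by the function [d t]. *)
Definition metric_quot (dP : pseudometric d) : Type := {f : T -> R | exists t, f = d t}.

Variable dP : pseudometric d.

Definition mq_class (t : T) : metric_quot dP := exist _ (d t) (ex_intro _ t erefl).
Definition mq_repr (x : metric_quot dP) : T := projT1 (cid (projT2 x)).

Lemma mq_eq (x y : metric_quot dP) : projT1 x = projT1 y -> x = y.
Proof. by case: x y => [f hf] [g hg] /= fg; exact: eq_exist. Qed.

Lemma mq_reprE (x : metric_quot dP) : projT1 x = d (mq_repr x).
Proof. by rewrite /mq_repr; case: cid. Qed.

HB.instance Definition _ := gen_eqMixin (metric_quot dP).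
HB.instance Definition _ := gen_choiceMixin (metric_quot dP).

Definition mq_dist (x y : metric_quot dP) : R := d (mq_repr x) (mq_repr y).

Let mq_distxx x : mq_dist x x = 0. Proof. exact: (pdistxx dP). Qed.

Let mq_dist_eq0 x y : mq_dist x y = 0 -> x = y.
Proof.
move=> xy; apply: mq_eq; rewrite !mq_reprE; apply/funext => t.
apply/eqP; rewrite -subr_eq0 -normr_le0.
by rewrite (le_trans (pdist_lip dP _ _ _))// -/(mq_dist x y) xy.
Qed.

Let mq_dist_sym x y : mq_dist x y = mq_dist y x. Proof. exact: (pdist_sym dP). Qed.

Let mq_dist_tri y x z : mq_dist x z <= mq_dist x y + mq_dist y z.
Proof. exact: (pdist_tri dP). Qed.

HB.instance Definition _ := isMetric.Build R (metric_quot dP)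
  mq_distxx mq_dist_eq0 mq_dist_sym mq_dist_tri.

Lemma mdist_class t u : mdist (mq_class t) (mq_class u) = d t u.
Proof.
rewrite [LHS]/(mq_dist _ _) /mq_dist.
have E v w : d (mq_repr (mq_class v)) w = d v w by rewrite -mq_reprE.
by rewrite E (pdist_sym dP) E (pdist_sym dP).
Qed.

Lemma mq_class_repr x : mq_class (mq_repr x) = x.
Proof. by apply: mq_eq; exact/esym/mq_reprE. Qed.

End MetricQuotient.

(** * Gluing two spaces along nets with nearly equal distances *)

Section Gluing.
Context {R : realType} {X Y : Type} (dX : X -> X -> R) (dY : Y -> Y -> R).
Hypotheses (dXP : pseudometric dX) (dYP : pseudometric dY).
Context {I : Type} (i0 : I) (a : I -> X) (b : I -> Y) (e : R).
Hypotheses (e0 : 0 < e) (ab : forall i j, `|dX (a i) (a j) - dY (b i) (b j)| <= e).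

Let links x y : set R := [set dX x (a i) + dY (b i) y | i in setT].
(** The shift [e], paid at each crossing, absorbs the distortion between [a] and [b] in the triangle
    inequality. *)
Let cross x y : R := inf (links x y) + e.

Let links_ge0 x y : lbound (links x y) 0.
Proof. by move=> _ [i _ <-]; rewrite addr_ge0// (pdist_ge0 dXP, pdist_ge0 dYP). Qed.

Let cross_le x y i : cross x y <= dX x (a i) + dY (b i) y + e.
Proof.
rewrite lerD2r; apply: ge_inf; last by exists i.
by exists 0; exact: links_ge0.
Qed.

Let le_cross x y t : (forall i, t <= dX x (a i) + dY (b i) y + e) -> t <= cross x y.
Proof.
move=> h; rewrite -lerBlDr; apply: lb_le_inf.
  by exists (dX x (a i0) + dY (b i0) y); exists i0.
by move=> _ [i _ <-]; rewrite lerBlDr.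
Qed.

Definition glue_dist (u v : X + Y) : R :=
  match u, v with
  | inl x, inl x' => dX x x'
  | inr y, inr y' => dY y y'
  | inl x, inr y | inr y, inl x => cross x y
  end.

Lemma glue_pseudometric : pseudometric glue_dist.
Proof.
have e0' := e0.
split.
- by case=> [x|y] /=; [exact: (pdistxx dXP)|exact: (pdistxx dYP)].
- by case=> [x|y] [x'|y'] //=; [exact: (pdist_sym dXP)|exact: (pdist_sym dYP)].
- case=> [x2|y2] [x1|y1] [x3|y3] /=.
  + exact: (pdist_tri dXP).
  + rewrite -lerBlDl; apply: le_cross => i; rewrite lerBlDl.
    rewrite (le_trans (cross_le _ _ i))//.
    have := pdist_tri dXP x2 x1 (a i); lra.
  + rewrite -lerBlDr; apply: le_cross => i; rewrite lerBlDr.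
    rewrite (le_trans (cross_le _ _ i))//.
    have := pdist_tri dXP x2 x3 (a i); rewrite (pdist_sym dXP x3 x2); lra.
  (* Ends in [Y], middle point in [X]: the two crossings contribute [2 e], more than the distortion
     [e] between the links [i] and [j]. *)
  + rewrite -lerBlDr; apply: le_cross => i; rewrite lerBlDr -lerBlDl.
    apply: le_cross => j; rewrite lerBlDl.
    have := pdist_tri dYP (b i) y1 y3; have := pdist_tri dYP (b j) (b i) y3.
    have := pdist_tri dXP x2 (a i) (a j); have /ler_distlCDr := ab i j.
    rewrite (pdist_sym dXP (a i) x2) (pdist_sym dYP y1 (b i)); lra.
  + rewrite -lerBlDr; apply: le_cross => i; rewrite lerBlDr -lerBlDl.
    apply: le_cross => j; rewrite lerBlDl.
    have := pdist_tri dXP (a i) x1 x3; have := pdist_tri dXP (a j) (a i) x3.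
    have := pdist_tri dYP y2 (b i) (b j); have /ler_distlDr := ab i j.
    rewrite (pdist_sym dXP x3 (a j)) (pdist_sym dYP y2 (b j)); lra.
  + rewrite -lerBlDr; apply: le_cross => i; rewrite lerBlDr.
    rewrite (le_trans (cross_le _ _ i))//.
    have := pdist_tri dYP y2 (b i) y3; lra.
  + rewrite -lerBlDl; apply: le_cross => i; rewrite lerBlDl.
    rewrite (le_trans (cross_le _ _ i))//.
    have := pdist_tri dYP y2 (b i) y1; rewrite (pdist_sym dYP y1 y2); lra.
  + exact: (pdist_tri dYP).
Qed.

(** Each point is within [e] of its net, whose members are at distance [e] from their partners;
    [3 e] exceeds the total [2 e] strictly. *)
Lemma gh_dist_glue : (forall x, exists i, dX x (a i) <= e) ->
  (forall y, exists i, dY y (b i) <= e) -> (gh_dist dX dY <= (3 * e)%:E)%E.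
Proof.
move=> na nb; have e0' := e0; pose cl := mq_class glue_pseudometric.
apply: ge_ereal_inf.
exists (hausdorff_dist (range (fun x => cl (inl x))) (range (fun y => cl (inr y)))).
  exists (metric_quot glue_pseudometric), (fun x => cl (inl x)), (fun y => cl (inr y)).
  by split=> // x y; rewrite mdist_class.
apply: ereal_inf_lbound; exists (3 * e) => //; split; first by rewrite mulr_gt0.
- move=> _ [x _ <-]; have [i xi] := na x; exists (cl (inr (b i))); first by exists (b i).
  rewrite mdist_class /= (le_lt_trans (cross_le _ _ i))//.
  by rewrite (pdistxx dYP); lra.
- move=> _ [y _ <-]; have [i yi] := nb y; exists (cl (inl (a i))); first by exists (a i).
  rewrite mdist_class /= (le_lt_trans (cross_le _ _ i))//.
  by rewrite (pdistxx dXP) (pdist_sym dYP); lra.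
Qed.

End Gluing.

Lemma gh_dist_ge0 {R : realType} {X Y : Type} (dX : X -> X -> R) (dY : Y -> Y -> R) :
  (0 <= gh_dist dX dY)%E.
Proof.
apply: le_ereal_inf_tmp => _ [Z [f [g [_ _ ->]]]].
by apply: le_ereal_inf_tmp => _ [e [e0 _ _] <-]; rewrite lee_fin ltW.
Qed.

Lemma filter_ltn (T : Type) (F : set_system T) (A : nat -> set T) N : Filter F ->
  (forall k, (k < N)%N -> F (A k)) -> F [set x | forall k, (k < N)%N -> A k x].
Proof.
move=> FF; elim: N => [|N IH] FA; first by apply: filterS filterT.
apply: filterS2 (IH (fun k kN => FA k (ltnW kN))) (FA N (ltnSn N)) => x h1 h2 k.
by rewrite ltnS leq_eqVlt => /orP[/eqP->|/h1].
Qed.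

Lemma ultra_ltn (T : Type) (F : set_system T) (A : nat -> set T) N : UltraFilter F ->
  F [set x | exists2 k, (k < N)%N & A k x] -> exists2 k, (k < N)%N & F (A k).
Proof.
move=> UF; have PF := ultra_proper; elim: N => [|N IH] FN.
  by exfalso; apply: (@filter_not_empty _ F); apply: filterS FN => x [].
have [FA|FA] := in_ultra_setVsetC (A N) UF; first by exists N.
have [k kN FAk] : exists2 k, (k < N)%N & F (A k).
  apply: IH; apply: filterS2 FN FA => x [k + Akx] nANx.
  rewrite ltnS leq_eqVlt => /orP[/eqP kN|kN]; last by exists k.
  by exfalso; apply: nANx; rewrite -kN.
by exists k => //; rewrite ltnW.
Qed.

(** * Compactness from total boundedness and completeness *)

Section MetricQuotientCompact.
Context {R : realType} {T : Type} {d : T -> T -> R} (dP : pseudometric d).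

(** An ultrafilter contains a ball of radius [2^-m / 2] for every [m], by total boundedness.
    Consecutive balls meet, so their centres form a fast Cauchy sequence, and the ultrafilter
    converges to its limit. *)
Lemma compact_metric_quot :
  (forall e : R, 0 < e -> exists N (f : nat -> T),
     forall t, exists2 k, (k < N)%N & d t (f k) <= e) ->
  (forall y : nat -> T, (forall m, d (y m) (y m.+1) <= 2^-1 ^+ m) ->
     exists t, forall m, d (y m) t <= 4 * 2^-1 ^+ m) ->
  compact [set: metric_quot dP].
Proof.
move=> tb cpl; rewrite compact_ultra => F UF _.
have PF := ultra_proper.
have h0 m : 0 < 2^-1 ^+ m :> R by rewrite exprn_gt0.
have ex m : exists t, F [set x | mdist (mq_class dP t) x <= 2^-1 ^+ m / 2].
  have e0 : 0 < 2^-1 ^+ m / 2 :> R by rewrite divr_gt0.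
  have [N [f fN]] := tb _ e0.
  have [|k kN Fk] := @ultra_ltn _ F (fun k => [set x | mdist (mq_class dP (f k)) x <= 2^-1 ^+ m / 2]) N UF.
    apply: filterS filterT => x _ /=.
    have [k kN xk] := fN (mq_repr x); exists k => //.
    by rewrite -(mq_class_repr x) mdist_class (pdist_sym dP).
  by exists (f k).
have [y Fy] := choice ex.
have [m|t yt] := cpl y.
  have [x [x1 x2]] := filter_ex (filterI (Fy m) (Fy m.+1)).
  rewrite -(mdist_class dP) (le_trans (metric_triangle _ x _))//.
  rewrite /= in x1 x2; rewrite metric_sym in x2; apply: (le_trans (lerD x1 x2)).
  by have := h0 m; rewrite exprS; lra.
exists (mq_class dP t); split => //= A /nbhs_ballP[e /= e0 eA].
(* From [t] to the centre costs [4 * 2^-m], from there to a point of the ball [2^-m / 2]. *)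
have [m me] : exists m, 5 * 2^-1 ^+ m < e.
  have h5 : 0 < e / 5 by rewrite divr_gt0.
  have c : (fun m => 2^-1 ^+ m : R) @ \oo --> (0 : R).
    by apply: cvg_expr; rewrite ger0_norm// invf_lt1// ltr1n.
  move/cvgrPdist_lt : c => /(_ _ h5)[m _ /(_ m (leqnn m))].
  rewrite sub0r normrN gtr0_norm// => hm.
  by exists m; lra.
apply: filterS (Fy m) => x /= xm; apply: eA; rewrite ballEmdist /=.
rewrite (le_lt_trans (metric_triangle _ (mq_class dP (y m)) _))//.
rewrite mdist_class (pdist_sym dP); have := yt m; have := h0 m; lra.
Qed.

End MetricQuotientCompact.

(** * Ultraproducts of uniformly bounded spaces *)

Section Ultraproduct.
Context {R : realType} {X : nat -> Type} (d : forall i, X i -> X i -> R).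
Hypothesis dP : forall i, pseudometric (@d i).
Variables (D : R) (U : set_system nat).
Hypotheses (dD : forall i x y, @d i x y <= D) (UU : UltraFilter U)
  (Uoo : forall A, (\oo : set_system nat) A -> U A).

Let UF : ProperFilter U := ultra_proper.

Definition ultra_dist (x y : forall i, X i) : R := lim (d (x i) (y i) @[i --> U]).

(** The distances lie in the compact interval [[0, D]], and a cluster point along an ultrafilter is
    a limit. *)
Lemma ultra_dist_cvg x y : d (x i) (y i) @[i --> U] --> ultra_dist x y.
Proof.
suff : cvg (d (x i) (y i) @[i --> U]) by [].
have cs := @segment_compact R 0 D.
have F0D : ((fun i => d (x i) (y i)) @ U) `[0, D]%classic.
  apply: (@filterS _ U _ setT); last exact: filterT.
  move=> i _ /=; rewrite in_itv/=; apply/andP; split; last exact: dD.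
  exact: (pdist_ge0 (dP i)).
have [l [_ cl]] := cs ((fun i => d (x i) (y i)) @ U) _ F0D.
apply/cvg_ex; exists l; apply/cvgrPdist_lt => e e0.
have [//|Ue] := in_ultra_setVsetC [set i | `|l - d (x i) (y i)| < e] UU.
have [z [hz1 hz2]] := cl [set z | ~ `|l - z| < e] _ Ue (nbhsx_ballx l e e0).
by exfalso; apply: hz1; exact: hz2.
Qed.

Lemma ultra_dist_le x y e :
  U [set i | d (x i) (y i) <= e] -> ultra_dist x y <= e.
Proof.
move=> h.
exact: (@cvgr_to_le _ _ _ _ (fun i => d (x i) (y i)) _ _ (@ultra_dist_cvg x y) h).
Qed.

Lemma ultra_dist_lt x y e : ultra_dist x y < e -> U [set i | d (x i) (y i) < e].
Proof.
move=> h; exact: (@cvgr_lt _ _ _ _ (fun i => d (x i) (y i)) _ (@ultra_dist_cvg x y) _ h).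
Qed.

Lemma ultra_pseudometric : pseudometric ultra_dist.
Proof.
split.
- move=> x; apply/cvg_lim => //.
  rewrite (_ : (fun i => _) = cst 0); first exact: cvg_cst.
  by apply/funext => i; exact: (pdistxx (dP i)).
- move=> x y; congr (lim (_ @ U)); apply/funext => i; exact: (pdist_sym (dP i)).
- move=> y x z.
  pose g i := d (x i) (y i) + d (y i) (z i) - d (x i) (z i).
  have c : g @ U --> ultra_dist x y + ultra_dist y z - ultra_dist x z.
    apply: cvgB; last exact: (@ultra_dist_cvg x z).
    by apply: cvgD; [exact: (@ultra_dist_cvg x y)|exact: (@ultra_dist_cvg y z)].
  rewrite -subr_ge0; apply: (cvgr_to_ge c).
  by apply: filterS filterT => i _; rewrite /g subr_ge0; exact: (pdist_tri (dP i)).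
Qed.

(* Diagonal argument: on coordinate [i], stop the sequence [y] at the last index
   [k i <= i] before a step that is too long on that coordinate. *)
Lemma ultra_complete (y : nat -> forall i, X i) :
  (forall m, ultra_dist (y m) (y m.+1) <= 2^-1 ^+ m) ->
  exists t, forall m, ultra_dist (y m) t <= 4 * 2^-1 ^+ m.
Proof.
move=> yc.
have h0 m : 0 < 2^-1 ^+ m :> R by rewrite exprn_gt0.
(* The factor 2 leaves strict room above the limit distance, so the bound holds for [U]-almost all
   [i]. *)
pose G a i := `[< d (y a i) (y a.+1 i) < 2 * 2^-1 ^+ a >].
have UG a : U (G a).
  have : ultra_dist (y a) (y a.+1) < 2 * 2^-1 ^+ a by have := yc a; have := h0 a; lra.
  by move=> /ultra_dist_lt; apply: filterS => i hi; apply/asboolP.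
pose P i m := (m <= i)%N && all (G^~ i) (iota 0 m).
have exm i : exists m, P i m /\ forall m', P i m' -> (m' <= m)%N.
  have exP : exists m, P i m by exists 0%N.
  have bP m : P i m -> (m <= i)%N by case/andP.
  by case: (ex_maxnP exP bP) => m Pm mm; exists m.
have [k hk] := choice exm.
have tail i m j : (forall a, (a < m + j)%N -> G a i) ->
    d (y m i) (y (m + j)%N i) <= 4 * (2^-1 ^+ m - 2^-1 ^+ (m + j)).
  elim: j => [|j IH] hG; first by rewrite addn0 subrr mulr0 (pdistxx (dP i)).
  have h1 := IH (fun a aj => hG a (leq_trans aj (leq_add (leqnn m) (leqnSn j)))).
  have /asboolP h2 : G (m + j)%N i by apply: hG; rewrite addnS.
  have := pdist_tri (dP i) (y (m + j)%N i) (y m i) (y (m + j.+1)%N i).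
  rewrite addnS exprS; rewrite -addnS; move: h1 h2; rewrite addnS; have := h0 (m + j)%N; lra.
exists (fun i => y (k i) i) => m; apply: ultra_dist_le.
(* As [U] refines the filter at infinity, the cap [k i <= i] does not keep [k i] below a fixed
   [m]. *)
have U1 : U [set i | (m <= i)%N] by apply: Uoo; exists m.
have U2 := filter_ltn UF (fun a (_ : (a < m)%N) => UG a).
apply: filterS2 U1 U2 => i /= mi Gi.
have [/andP[_ /allP ka] kmax] := hk i.
have mk : (m <= k i)%N.
  apply: kmax; rewrite /P mi; apply/allP => a; rewrite mem_iota => /andP[_ am].
  exact: Gi.
have := tail i m (k i - m)%N; rewrite subnKC// => h.
apply: le_trans (h _) _; first by move=> a ak; apply: ka; rewrite mem_iota.
by have := h0 (k i); lra.
Qed.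

End Ultraproduct.

(** * Gromov's precompactness theorem *)

Section Precompactness.
Context {R : realType}.

Lemma mdist_pseudometric (Y : metricType R) : pseudometric (@mdist R Y).
Proof.
by split; [exact: mdistxx|exact: metric_sym|move=> y x z; exact: metric_triangle].
Qed.

(** Nets of uniform size in the factors give a net of the ultraproduct, and for [U]-almost all [i]
    all distances between net points are within [e] of their limits; gluing along the nets makes
    [X i] close to [Y]. *)
Lemma gromov_precompactness (X : nat -> Type) (d : forall i, X i -> X i -> R) (D : R) :
  (forall i, X i) -> (forall i, pseudometric (@d i)) -> (forall i x y, @d i x y <= D) ->
  (forall e : R, 0 < e -> exists N, forall i, exists f : nat -> X i,
     forall y, exists2 k, (k < N)%N & d i y (f k) < e) ->
  exists s : nat -> nat, increasing_seq s /\
    exists Y : metricType R, compact [set: Y] /\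
      gh_dist (@d (s k)) (@mdist R Y) @[k --> \oo] --> 0%E.
Proof.
move=> x0 dP dD net.
have [U [UU Uoo]] := ultraFilterLemma (eventually_filter : ProperFilter (\oo : set_system nat)).
have UF := @ultra_proper _ U UU.
pose rho := ultra_dist d U.
have rhoP : pseudometric rho by exact: (ultra_pseudometric dP dD UU).
have rho_cvg x y := ultra_dist_cvg dP dD UU (x := x) (y := y).
pose Y : metricType R := metric_quot rhoP.
have nets e : 0 < e -> exists N (F : nat -> forall i, X i), forall i y,
    exists2 k, (k < N)%N & d i y (F k i) < e.
  move=> e0; have [N hN] := net e e0; exists N.
  by exists (fun k i => sval (cid (hN i)) k) => i y; case: (cid (hN i)) => f /=.
have netY e N (F : nat -> forall i, X i) :
    (forall i y, exists2 k, (k < N)%N & d i y (F k i) < e) ->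
    forall t, exists2 k, (k < N)%N & rho t (F k) <= e.
  move=> hF t.
  have [|k kN Uk] := @ultra_ltn _ U (fun k => [set i | d i (t i) (F k i) < e]) N UU.
    by apply: filterS filterT => i _; exact: hF.
  exists k => //; apply: (ultra_dist_le dP dD UU).
  by apply: filterS Uk => i /ltW.
have cY : compact [set: Y].
  apply: compact_metric_quot; last exact: (ultra_complete dP dD UU Uoo).
  by move=> e /nets[N [F hF]]; exists N, F; exact: netY hF.
have close e : 0 < e -> U [set i | (gh_dist (@d i) (@mdist R Y) <= (3 * e)%:E)%E].
  move=> e0; have [N [F hF]] := nets e e0.
  have h : U [set i | forall a, (a < N)%N -> forall b, (b < N)%N ->
      `|d i (F a i) (F b i) - rho (F a) (F b)| <= e].
    apply: filter_ltn => a _; apply: filter_ltn => b _.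
    have /cvgrPdist_lt/(_ e e0) := rho_cvg (F a) (F b).
    by apply: filterS => i /ltW; rewrite distrC.
  apply: filterS h => i hi /=.
  have [k kN _] := hF i (x0 i).
  apply: (@gh_dist_glue _ _ _ _ _ (dP i) (mdist_pseudometric Y) 'I_N (Ordinal kN)
    (fun a => F a i) (fun a => mq_class rhoP (F a))) => //.
  - by move=> a b; rewrite mdist_class; exact: hi.
  - by move=> x; have [a aN /ltW xa] := hF i x; exists (Ordinal aN).
  - move=> y; have [a aN ya] := netY _ _ _ hF (mq_repr y); exists (Ordinal aN).
    by rewrite -(mq_class_repr y) mdist_class.
(* Sets in [U] meet every tail, so close indices exist beyond any [j]; iterating this choice builds
   the subsequence. *)
have pick k j : exists i, (j < i)%N /\
    (gh_dist (@d i) (@mdist R Y) <= (3 * k.+1%:R^-1)%:E)%E.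
  have k0 : 0 < k.+1%:R^-1 :> R by rewrite invr_gt0.
  have Uj : U [set i | (j < i)%N] by apply: Uoo; exists j.+1.
  by have [i [ij ik]] := filter_ex (filterI Uj (close _ k0)); exists i.
have [p hp] := choice (fun kj : nat * nat => pick kj.1 kj.2).
pose s := fix s k := if k is k'.+1 then p (k, s k') else p (0%N, 0%N).
exists s; split; first by apply/increasing_seqP => k; have [] := hp (k.+1, s k).
exists Y; split=> //.
have sk k : (gh_dist (@d (s k)) (@mdist R Y) <= (3 * k.+1%:R^-1)%:E)%E.
  by case: k => [|k]; [have [] := hp (0, 0)%N|have [] := hp (k.+1, s k)].
apply: (@squeeze_cvge _ _ _ _ (cst 0%E) _ (fun k => (3 * k.+1%:R^-1)%:E)).
- by apply: nearW => k; rewrite gh_dist_ge0 sk.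
- exact: cvg_cst.
- apply: cvg_EFin; first exact: nearW.
  rewrite -(mulr0 (3 : R)); apply: cvgM; first exact: cvg_cst.
  exact: cvg_harmonic.
Qed.

End Precompactness.

(** * Diameter bound, convergence and noncollapsing *)

Theorem theorem2 (R : realType) (n : nat) (r0 alpha beta C V0 : R)
  (hn : (1 <= n)%N) (hr0 : 0 < r0)
  (halpha : 0 < alpha) (hab : alpha < beta) (hbeta : beta < 2)
  (hC : 0 < C) (hV0 : 0 < V0) :
  exists D0 : R, 0 < D0 /\
    forall M : nat -> closed_oriented_riemannian R n,
      (forall i, (riem_vol (M i) <= V0%:E)%E) ->
      (forall i (r : R), 0 < r -> r <= r0 ->
         tetrahedral (@riem_dist R n (M i)) n C alpha beta r) ->
      (exists s : nat -> nat, increasing_seq s /\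
         (exists Y : metricType R, compact [set: Y] /\
            gh_dist (@riem_dist R n (M (s k))) (@mdist R Y) @[k --> \oo] --> 0%E) /\
         exists v : R, 0 < v /\ forall k, (v%:E <= riem_vol (M (s k)))%E) /\
      forall i, (diam (@riem_dist R n (M i)) <= D0%:E)%E.
Proof.
pose K r := packing_const R n * V0 / annulus_content n alpha beta r.
have P0 : 0 < packing_const R n :> R by exact: packing_const_gt0.
have A0 r : 0 < r -> 0 < annulus_content n alpha beta r by exact: annulus_content_gt0.
have K0 r : 0 < r -> 0 < K r by move=> rp; apply: divr_gt0; [exact: mulr_gt0|exact: A0].
exists ((K r0 + 1) * r0); split; first by rewrite mulr_gt0// addr_gt0// K0.
move=> M vol tet.
have dD i (x y : M i) : riem_dist x y <= (K r0 + 1) * r0.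
  exact: (riem_dist_bound hn hr0 hab hC (tet i) (vol i)).
split; last first.
  by move=> i; apply: ge_ereal_sup => _ [[x y] _ <-]; rewrite lee_fin.
have x0 i : M i by have /cid[x _] := mfd_nonempty (M i).
have [|s [si sY]] := gromov_precompactness x0 (fun i => riem_dist_pseudometric (M i)) dD.
  (* The packing bound holds for radii up to [r0]; the resulting net size depends on [r] alone, so
     it is uniform in [i]. *)
  move=> e e0; pose r := Num.min e r0.
  have rp : 0 < r by rewrite lt_min e0.
  have rr0 : r <= r0 by rewrite ge_min lexx orbT.
  exists (Num.trunc (K r)) => i.
  have [|f hf] := @net_of_packing R (M i) (@riem_dist R n (M i)) r (Num.trunc (K r))
      (x0 i) (riem_dist_pseudometric (M i)) rp.
    move=> m x sep; have := packing_bound hn hab hC (tet i) (vol i) rp rr0 sep.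
    by rewrite -/(K r) truncn_ge_nat // ltW// K0.
  exists f => y; have [k kN yk] := hf y; exists k => //.
  by rewrite (lt_le_trans yk)// ge_min lexx.
exists s; split=> //; split=> //.
exists (annulus_content n alpha beta r0 / packing_const R n); split.
  by rewrite divr_gt0// A0.
by move=> k; exact: (riem_vol_ge hn hr0 hab hC (tet (s k))).
Qed.
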